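(* Let $(M^{2m},\varphi,g)$ be a para-Kähler-Norden manifold, $T^{\varphi}_{1}M$ its $\varphi$-unit tangent bundle equipped with the $\varphi$-Sasaki metric, and $F$ a $(1,1)$-tensor field on $M$. If $\Gamma=(\gamma(t),\xi(t))$ is a horizontal lift of $\gamma$ and $\Gamma$ lies in $T^{\varphi}_{1}M$, then $\Gamma$ is an ${}^{H}F$-planar curve (resp., ${}^{H}F$-geodesic) if and only if $\gamma$ is an $F$-planar curve (resp., $F$-geodesic).
   Context: A para-Kähler-Norden manifold $(M^{2m},\varphi,g)$ is a $2m$-dimensional Riemannian manifold $(M,g)$ with a $(1,1)$-tensor field $\varphi$ such that $\varphi^2=\mathrm{id}$, $\varphi\ne\pm\mathrm{id}$, the $+1$ and $-1$ eigenbundles of $\varphi$ have equal rank, $g(\varphi X,Y)=g(X,\varphi Y)$, and $\nabla\varphi=0$, where $\nabla$ is the Levi-Civita connection of $g$. Points of $TM$ are written $(x,\xi)$; ${}^{H}X$, ${}^{V}X$ are the horizontal (with respect to $\nabla$) and vertical lifts to $TM$. The $\varphi$-Sasaki metric $g^\varphi$ on $TM$ is defined by $g^\varphi({}^HX,{}^HY)=g(X,Y)$, $g^\varphi({}^HX,{}^VY)=0$, $g^\varphi({}^VX,{}^VY)=g(X,\varphi Y)$. The $\varphi$-unit tangent bundle is the hypersurface $T^{\varphi}_{1}M=\{(x,\xi)\in TM: g(\xi,\varphi\xi)=1\}$, equipped with the metric induced by $g^\varphi$; $\widehat\nabla$ is the Levi-Civita connection of this induced metric. The horizontal lift ${}^HF$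 of $F$ is the $(1,1)$-tensor field on $TM$ with ${}^HF({}^HX)={}^H(FX)$ and ${}^HF({}^VX)={}^V(FX)$. A curve $\Gamma=(\gamma(t),\xi(t))$ consists of a curve $\gamma$ on $M$ and a vector field $\xi$ along $\gamma$. Write $\gamma_t'=d\gamma/dt$, $\gamma_t''=\nabla_{\gamma_t'}\gamma_t'$, $\xi_t'=\nabla_{\gamma_t'}\xi$. $\Gamma$ is a horizontal lift of $\gamma$ if $\xi_t'=0$. $\gamma$ is $F$-planar if $\gamma_t''=\varrho_1\gamma_t'+\varrho_2F\gamma_t'$ for some functions $\varrho_1,\varrho_2$ of $t$, and an $F$-geodesic if $\gamma_t''=F\gamma_t'$. $\Gamma$ is ${}^HF$-planar if $\widehat\nabla_{\Gamma_t'}\Gamma_t'=\varrho_1\Gamma_t'+\varrho_2\,{}^HF\,\Gamma_t'$ for some functions $\varrho_1,\varrho_2$ of $t$, and an ${}^HF$-geodesic if $\widehat\nabla_{\Gamma_t'}\Gamma_t'={}^HF\,\Gamma_t'$. *)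

(* Defs.v *)
From HB Require Import structures.
From mathcomp Require Import all_boot all_order all_algebra.
From mathcomp Require Import all_classical all_reals all_analysis.
Set Implicit Arguments.
Unset Strict Implicit.
Unset Printing Implicit Defensive.
Import Order.TTheory GRing.Theory Num.Theory.
Import numFieldNormedType.Exports.
Local Open Scope classical_set_scope.
Local Open Scope ring_scope.

(* Tangent vectors are row vectors of components in a chart;
   linear maps and Jacobians act on the right: ['d f x v = v *m 'J f x]. *)

(* [Ck k U f]: f is of class C^k on U, where U is meant to be open. *)
Fixpoint Ck (R : realType) (V W : normedModType R) (k : nat)
    (U : set V) (f : V -> W) : Prop :=
  if k is k'.+1 then
    (forall x, U x -> differentiable f x) /\ (forall v, Ck k' U ('D_v f))
  else forall x, U x -> {for x, continuous f}.

Definition smooth_on (R : realType) (V W : normedModType R)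
    (U : set V) (f : V -> W) : Prop := forall k, Ck k U f.

(* Manifolds are given, as in do Carmo, by a set of points and a family of
   charts; the topology is the one induced by the charts.  [chart_map i] is
   meaningful on [cdom i] only, [chart_inv i] on the image [cimg i] only. *)
Record atlas (R : realType) (d : nat) := Atlas {
  mpoint : Type;
  carrier : set mpoint;
  chart : Type;
  cdom : chart -> set mpoint;
  chart_map : chart -> mpoint -> 'rV[R]_d;
  chart_inv : chart -> 'rV[R]_d -> mpoint }.
Arguments carrier {R d} _ _.

Section Manifold.
Context {R : realType} {d : nat}.
Implicit Type M : atlas R d.

Definition cimg M (i : chart M) : set 'rV[R]_d := chart_map i @` cdom i.

Definition transition M (i j : chart M) : 'rV[R]_d -> 'rV[R]_d :=
  chart_map j \o chart_inv i.

Definition atlas_open M (O : set (mpoint M)) : Prop :=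
  O `<=` carrier M /\ forall i : chart M, open (chart_map i @` (O `&` cdom i)).

Record smooth_manifold M : Prop := SmoothManifold {
  cdom_carrier : forall i : chart M, cdom i `<=` carrier M;
  chart_cover : forall p, carrier M p -> exists i : chart M, cdom i p;
  chart_mapK : forall (i : chart M) p, cdom i p -> chart_inv i (chart_map i p) = p;
  open_overlap : forall i j : chart M, open (chart_map i @` (cdom i `&` cdom j));
  smooth_transition : forall i j : chart M,
    smooth_on (chart_map i @` (cdom i `&` cdom j)) (transition i j);
  hausdorff_atlas : forall p q, carrier M p -> carrier M q -> p <> q ->
    exists O O' : set (mpoint M),
      [/\ atlas_open O, atlas_open O', O p, O' q & O `&` O' = set0];
  countable_base_atlas : exists B : nat -> set (mpoint M),
    (forall k, atlas_open (B k)) /\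
    (forall O p, atlas_open O -> O p -> exists k, B k p /\ B k `<=` O) }.

(* A tangent vector at p is the family of its components in all the charts
   around p; the components in the other charts are set to 0. *)
Definition tangent M (p : mpoint M) (v : chart M -> 'rV[R]_d) : Prop :=
  (forall i j, cdom i p -> cdom j p ->
     v j = v i *m 'J (transition i j) (chart_map i p)) /\
  (forall i, ~ cdom i p -> v i = 0).

Definition tangent_of_chart M (i : chart M) (p : mpoint M) (u : 'rV[R]_d) :
    chart M -> 'rV[R]_d :=
  fun j => if `[< cdom j p >] then u *m 'J (transition i j) (chart_map i p) else 0.

(* Covariant 2-tensor fields, (1,1)-tensor fields and affine connections are
   given by their components in each chart: [cf i x u v] stands for the vector
   with k-th component \sum_(a, b) Gamma^k_{ab}(x) u^a v^b. *)
Definition form_field M := chart M -> 'rV[R]_d -> 'rV[R]_d -> 'rV[R]_d -> R.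
Definition endo_field M := chart M -> 'rV[R]_d -> 'M[R]_d.
Definition conn_field M :=
  chart M -> 'rV[R]_d -> 'rV[R]_d -> 'rV[R]_d -> 'rV[R]_d.

Record riemannian_metric M (g : form_field M) : Prop := RiemannianMetric {
  metric_linear : forall i x, cimg i x ->
    forall v (a : R) u u', g i x (a *: u + u') v = a * g i x u v + g i x u' v;
  metric_sym : forall i x, cimg i x -> forall u v, g i x u v = g i x v u;
  metric_pos : forall i x, cimg i x -> forall u, u != 0 -> 0 < g i x u u;
  metric_smooth : forall i u v, smooth_on (cimg i) (fun x => g i x u v);
  metric_tensorial : forall (i j : chart M) p, cdom i p -> cdom j p ->
    let J := 'J (transition i j) (chart_map i p) in
    forall u v, g i (chart_map i p) u v = g j (chart_map j p) (u *m J) (v *m J) }.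

Record endo_tensor M (F : endo_field M) : Prop := EndoTensor {
  endo_smooth : forall i, smooth_on (cimg i) (F i);
  endo_tensorial : forall (i j : chart M) p, cdom i p -> cdom j p ->
    let J := 'J (transition i j) (chart_map i p) in
    F i (chart_map i p) *m J = J *m F j (chart_map j p) }.

Record affine_connection M (cf : conn_field M) : Prop := AffineConnection {
  conn_linearl : forall i x, cimg i x -> forall v (a : R) u u',
    cf i x (a *: u + u') v = a *: cf i x u v + cf i x u' v;
  conn_linearr : forall i x, cimg i x -> forall u (a : R) v v',
    cf i x u (a *: v + v') = a *: cf i x u v + cf i x u v';
  conn_smooth : forall i u v, smooth_on (cimg i) (fun x => cf i x u v);
  conn_transition : forall (i j : chart M) p, cdom i p -> cdom j p ->
    let x := chart_map i p in
    let J := 'J (transition i j) x in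
    forall u v, cf i x u v *m J =
      'D_u ('D_v (transition i j)) x + cf j (chart_map j p) (u *m J) (v *m J) }.

(* The form G need not be definite. *)
Record levi_civita M (G : form_field M) (cf : conn_field M) : Prop :=
  LeviCivita {
  lc_connection : affine_connection cf;
  lc_torsion_free : forall i x, cimg i x -> forall u v, cf i x u v = cf i x v u;
  lc_metric : forall i x, cimg i x -> forall u v w,
    'D_w (fun y => G i y u v) x = G i x (cf i x w u) v + G i x u (cf i x w v) }.

Record smooth_curve M (I : set R) (c : R -> mpoint M) : Prop := SmoothCurve {
  curve_carrier : forall t, I t -> carrier M (c t);
  curve_open : forall i : chart M, open (I `&` c @^-1` cdom i);
  curve_smooth : forall i : chart M,
    smooth_on (I `&` c @^-1` cdom i) (fun t => chart_map i (c t)) }.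

(* The next two are families of components, meaningful in the charts around
   [c t]; V is a vector field along c. *)
Definition velocity M (c : R -> mpoint M) (t : R) : chart M -> 'rV[R]_d :=
  fun i => derive1 (fun s => chart_map i (c s)) t.

Definition cov_deriv M (cf : conn_field M) (c : R -> mpoint M)
    (V : R -> chart M -> 'rV[R]_d) (t : R) : chart M -> 'rV[R]_d :=
  fun i => derive1 (fun s => V s i) t
           + cf i (chart_map i (c t)) (velocity c t i) (V t i).

Definition acceleration M (cf : conn_field M) (c : R -> mpoint M) :=
  cov_deriv cf c (velocity c).

Definition F_planar M (cf : conn_field M) (F : endo_field M)
    (I : set R) (c : R -> mpoint M) : Prop :=
  exists rho1 rho2 : R -> R, forall t, I t -> forall i, cdom i (c t) ->
    acceleration cf c t i =
      rho1 t *: velocity c t i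
      + rho2 t *: (velocity c t i *m F i (chart_map i (c t))).

Definition F_geodesic M (cf : conn_field M) (F : endo_field M)
    (I : set R) (c : R -> mpoint M) : Prop :=
  forall t, I t -> forall i, cdom i (c t) ->
    acceleration cf c t i = velocity c t i *m F i (chart_map i (c t)).

End Manifold.

Record para_kahler_norden (R : realType) (m : nat) (M : atlas R m.*2)
    (g : form_field M) (nabla : conn_field M) (phi : endo_field M) : Prop :=
  ParaKahlerNorden {
  pkn_manifold : smooth_manifold M;
  pkn_metric : riemannian_metric g;
  pkn_levi_civita : levi_civita g nabla;
  pkn_tensor : endo_tensor phi;
  pkn_involution : forall i x, cimg i x -> phi i x *m phi i x = 1%:M;
  pkn_neq_id : ~ (forall i x, cimg i x -> phi i x = 1%:M);
  pkn_neq_opp_id : ~ (forall i x, cimg i x -> phi i x = - 1%:M);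
  pkn_equal_rank : forall i x, cimg i x ->
    \rank (eigenspace (phi i x) 1) = \rank (eigenspace (phi i x) (-1));
  pkn_compatible : forall i x, cimg i x -> forall u v,
    g i x (u *m phi i x) v = g i x u (v *m phi i x);
  pkn_parallel : forall i x, cimg i x -> forall u v,
    'D_u (fun y => v *m phi i y) x + nabla i x u (v *m phi i x)
      - nabla i x u v *m phi i x = 0 }.

Section TangentBundle.
Context {R : realType} {n : nat}.
Implicit Type M : atlas R n.

(* Coordinates on TM: the row (x, xi) of size n + n. *)
Definition tangent_bundle M : atlas R (n + n) := {|
  mpoint := (mpoint M * (chart M -> 'rV[R]_n))%type;
  carrier := [set q | carrier M q.1 /\ tangent q.1 q.2];
  chart := chart M;
  cdom := fun i => [set q | [/\ carrier M q.1, tangent q.1 q.2 & cdom i q.1]];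
  chart_map := fun i q => row_mx (chart_map i q.1) (q.2 i);
  chart_inv := fun i z => let p := chart_inv i (lsubmx z) in
                      (p, tangent_of_chart i p (rsubmx z)) |}.

Variables (M : atlas R n) (nabla : conn_field M).

(* z = (x, xi) are the coordinates of a point of TM in the chart i, u the
   components of a vector of T_xM, a those of a vector of T_zTM. *)
Definition hlift (i : chart M) (z : 'rV[R]_(n + n)) (u : 'rV[R]_n) :
    'rV[R]_(n + n) := row_mx u (- nabla i (lsubmx z) u (rsubmx z)).

Definition vlift (u : 'rV[R]_n) : 'rV[R]_(n + n) := row_mx 0 u.

Definition hpart (a : 'rV[R]_(n + n)) : 'rV[R]_n := lsubmx a.

Definition vpart (i : chart M) (z a : 'rV[R]_(n + n)) : 'rV[R]_n :=
  rsubmx a + nabla i (lsubmx z) (lsubmx a) (rsubmx z).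

Definition phi_sasaki (g : form_field M) (phi : endo_field M) :
    form_field (tangent_bundle M) :=
  fun (i : chart M) z a b => let x := lsubmx z in
    g i x (hpart a) (hpart b) + g i x (vpart i z a) (vpart i z b *m phi i x).

Definition endo_hlift (F : endo_field M) (i : chart M)
    (z a : 'rV[R]_(n + n)) : 'rV[R]_(n + n) := let x := lsubmx z in
  hlift i z (hpart a *m F i x) + vlift (vpart i z a *m F i x).

Lemma hpart_hlift i z u : hpart (hlift i z u) = u.
Proof. by rewrite /hpart /hlift row_mxKl. Qed.

Lemma hpart_vlift u : hpart (vlift u) = 0.
Proof. by rewrite /hpart /vlift row_mxKl. Qed.

Lemma vpart_hlift i z u : vpart i z (hlift i z u) = 0.
Proof. by rewrite /vpart /hlift row_mxKl row_mxKr addNr. Qed.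

Lemma hv_decomposition i z a : a = hlift i z (hpart a) + vlift (vpart i z a).
Proof.
by rewrite /hlift /vlift /hpart /vpart add_row_mx addr0 addrCA addNr addr0 hsubmxK.
Qed.

Lemma vpart_vlift i z u : affine_connection nabla -> cimg i (lsubmx z) ->
  vpart i z (vlift u) = u.
Proof.
move=> D ix; rewrite /vpart /vlift row_mxKl row_mxKr.
have := conn_linearl D ix (rsubmx z) (-1) 0 0.
by rewrite scaler0 addr0 scaleN1r addNr => ->; rewrite addr0.
Qed.

Section LiftFormulas.
Variables (g : form_field M) (phi F : endo_field M).
Variables (i : chart M) (z : 'rV[R]_(n + n)).
Hypotheses (Dn : affine_connection nabla) (gR : riemannian_metric g).
Hypothesis (iz : cimg i (lsubmx z)).

Let g0l v : g i (lsubmx z) 0 v = 0.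
Proof.
have := metric_linear gR iz v (-1) 0 0.
by rewrite scaler0 addr0 mulN1r addNr.
Qed.

Let g0r u : g i (lsubmx z) u 0 = 0.
Proof. by rewrite (metric_sym gR iz). Qed.

Lemma phi_sasaki_hh u v :
  phi_sasaki g phi i z (hlift i z u) (hlift i z v) = g i (lsubmx z) u v.
Proof. by rewrite /phi_sasaki !hpart_hlift !vpart_hlift g0l addr0. Qed.

Lemma phi_sasaki_hv u v :
  phi_sasaki g phi i z (hlift i z u) (vlift v) = 0.
Proof. by rewrite /phi_sasaki hpart_vlift vpart_hlift g0l g0r addr0. Qed.

Lemma phi_sasaki_vv u v :
  phi_sasaki g phi i z (vlift u) (vlift v) =
  g i (lsubmx z) u (v *m phi i (lsubmx z)).
Proof. by rewrite /phi_sasaki !hpart_vlift !vpart_vlift // g0l add0r. Qed.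

Lemma endo_hlift_h u :
  endo_hlift F i z (hlift i z u) = hlift i z (u *m F i (lsubmx z)).
Proof.
by rewrite /endo_hlift hpart_hlift vpart_hlift mul0mx /vlift row_mx0 addr0.
Qed.

Lemma endo_hlift_v u :
  endo_hlift F i z (vlift u) = vlift (u *m F i (lsubmx z)).
Proof.
rewrite /endo_hlift hpart_vlift vpart_vlift // mul0mx.
rewrite {2}(hv_decomposition i z (vlift _)) hpart_vlift vpart_vlift //.
Qed.

End LiftFormulas.

End TangentBundle.

Section Submanifold.
Context {R : realType} {e : nat}.

(* A local parametrization of a d-dimensional embedded submanifold S of N,
   with values in a single chart of N: a smooth immersion which is a
   homeomorphism from an open set onto a relatively open subset of S. *)
Record local_param (N : atlas R e) (S : set (mpoint N)) (d : nat) :=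
  LocalParam {
  lp_chart : chart N;
  lp_dom : set 'rV[R]_d;
  lp_map : 'rV[R]_d -> 'rV[R]_e;
  lp_inv : 'rV[R]_e -> 'rV[R]_d;
  lp_open : open lp_dom;
  lp_mapK : forall w, lp_dom w -> lp_inv (lp_map w) = w;
  lp_smooth : smooth_on lp_dom lp_map;
  lp_immersion : forall w, lp_dom w -> row_free ('J lp_map w);
  lp_embedding : forall W, open W -> W `<=` lp_dom -> exists2 O, open O &
    lp_map @` W = O `&` (chart_map lp_chart @` (S `&` cdom lp_chart)) }.

Definition submanifold (N : atlas R e) (S : set (mpoint N)) (d : nat) :
    atlas R d := {|
  mpoint := mpoint N;
  carrier := S;
  chart := local_param S d;
  cdom := fun s => [set q | [/\ S q, cdom (lp_chart s) q &
                       (lp_map s @` lp_dom s) (chart_map (lp_chart s) q)]];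
  chart_map := fun s q => lp_inv s (chart_map (lp_chart s) q);
  chart_inv := fun s w => chart_inv (lp_chart s) (lp_map s w) |}.

Variables (N : atlas R e) (S : set (mpoint N)) (d : nat).

(* Components, in the chart [lp_chart s] of N, of the image under the
   inclusion of the vector with components u at w in the chart s. *)
Definition inclusion_push (s : local_param S d) (w u : 'rV[R]_d) : 'rV[R]_e :=
  u *m 'J (lp_map s) w.

Definition induced_metric (G : form_field N) : form_field (submanifold S d) :=
  fun (s : local_param S d) w u v =>
    G (lp_chart s) (lp_map s w) (inclusion_push s w u) (inclusion_push s w v).

End Submanifold.

Section UnitTangentBundle.
Context {R : realType} {n : nat}.
Variables (M : atlas R n) (g : form_field M) (phi : endo_field M).

Definition phi_unit_set : set (mpoint (tangent_bundle M)) :=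
  [set q | carrier (tangent_bundle M) q /\
     forall i : chart M, cdom i q.1 ->
       g i (chart_map i q.1) (q.2 i) (q.2 i *m phi i (chart_map i q.1)) = 1].

Definition phi_unit_bundle : atlas R (n + n).-1 :=
  submanifold phi_unit_set (n + n).-1.

Definition phi_unit_metric (nabla : conn_field M) : form_field phi_unit_bundle :=
  induced_metric (phi_sasaki nabla g phi).

Variables (nabla : conn_field M) (nabla_hat : conn_field phi_unit_bundle).

(* These are equations between vectors tangent to TM, since HF need not
   preserve the tangent spaces of the unit bundle: the acceleration is pushed
   forward by the inclusion.  Gamma is viewed as a curve of the submanifold for
   the acceleration, and as a curve of TM on the right-hand sides. *)
Definition HF_planar (F : endo_field M) (I : set R)
    (Gamma : R -> mpoint (tangent_bundle M)) : Prop :=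
  exists rho1 rho2 : R -> R, forall t, I t ->
    forall s : chart phi_unit_bundle, cdom s (Gamma t) ->
    let j := lp_chart s in
    let Gamma' := velocity (M := tangent_bundle M) Gamma t j in
    inclusion_push s (chart_map s (Gamma t)) (acceleration nabla_hat Gamma t s) =
      rho1 t *: Gamma'
      + rho2 t *: endo_hlift nabla F j (chart_map j (Gamma t)) Gamma'.

Definition HF_geodesic (F : endo_field M) (I : set R)
    (Gamma : R -> mpoint (tangent_bundle M)) : Prop :=
  forall t, I t ->
    forall s : chart phi_unit_bundle, cdom s (Gamma t) ->
    let j := lp_chart s in
    let Gamma' := velocity (M := tangent_bundle M) Gamma t j in
    inclusion_push s (chart_map s (Gamma t)) (acceleration nabla_hat Gamma t s) =
      endo_hlift nabla F j (chart_map j (Gamma t)) Gamma'.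

End UnitTangentBundle.
Arguments phi_unit_metric {R n M} g phi nabla _ _ _ _.

Definition horizontal_along (R : realType) (n : nat) (M : atlas R n)
    (nabla : conn_field M) (I : set R) (c : R -> mpoint M)
    (V : R -> chart M -> 'rV[R]_n) : Prop :=
  forall t, I t -> forall i, cdom i (c t) -> cov_deriv nabla c V t i = 0.

(* Main.v *)
Require Import Defs.
From HB Require Import structures.
From mathcomp Require Import all_boot all_order all_algebra.
From mathcomp Require Import all_classical all_reals all_analysis.
From mathcomp Require Import ring lra.
Set Implicit Arguments.
Unset Strict Implicit.
Unset Printing Implicit Defensive.
Import Order.TTheory GRing.Theory Num.Theory.
Import numFieldNormedType.Exports.
Local Open Scope classical_set_scope.
Local Open Scope ring_scope.

(* Let Gamma = (gamma, xi) be a horizontal lift inside the unit bundle.  The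
   claim reduces to one identity: the acceleration of Gamma for the induced
   metric is the horizontal lift of the acceleration of gamma.  In a local
   parametrization f of the hypersurface, Koszul's formula expresses the pairing
   of the acceleration with a tangent vector of the hypersurface by derivatives
   of the induced metric; since the velocity of Gamma is horizontal, the
   vertical terms cancel and only g(gamma'', horizontal part) is left.  Hence
   the acceleration of Gamma minus the lift of gamma'' is orthogonal to the
   hypersurface.  It is also orthogonal to the vertical lift of xi, which is
   normal to the hypersurface and not null (its square is 1), so it vanishes by
   nondegeneracy.  Transferring the equation back to gamma in a given chart
   requires a local parametrization of the hypersurface over that chart; as
   g(xi, phi xi) is quadratic in xi, one is obtained by rescaling the vectors of
   an affine hyperplane. *)

(** * Differentials *)

(** Smoothness is assumed for Gamma as a curve of TM only, and the inverse of a local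
    parametrization [f] is not known to be differentiable, whereas velocity and acceleration on the
    hypersurface differentiate the coordinates [w] of Gamma twice. So [w'] and [w''] have to be
    recovered from [f o w = z], and then from the linear system satisfied by [w'], using a one-sided
    inverse of the Jacobian. The Levi-Civita connection of the hypersurface is never computed. The
    acceleration contains only its value at [(w', w')], whose pairing with a tangent vector b is
    D_a<a,b> - (1/2) D_b<a,a> for a = [w']. Since g and phi are parallel, these derivatives involve
    only covariant derivatives of the horizontal and vertical components of coordinate fields. The
    symmetry of the horizontal ones rests on Schwarz's theorem; the asymmetry of the vertical ones
    is the curvature. *)

Section Differentiation.
Context {R : realType}.
Implicit Types V W X : normedModType R.

(** After translation to 0 the two functions share their first-order expansion; uniqueness of the
    differential then gives its value. *)
Lemma near_eq_is_diff V W (f g df : V -> W) (p : V) :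
  (\forall q \near p, f q = g q) -> is_diff p f df -> is_diff p g df.
Proof.
move=> fg [fp <-].
have gp : g \o shift p = cst (g p) + 'd f p +o_ 0 id.
  have /diff_locallyP[_ /eqaddoP fo] := fp.
  apply/eqaddoP => e /fo; rewrite !near_simpl; apply: filter_app.
  have fg0 : \forall h \near 0, f (h + p) = g (h + p).
    have := fg; rewrite (near_shift 0 p) /=.
    by apply: filter_app; near=> h => /=; rewrite subr0.
  near=> h; rewrite -![(_ + _ : _ -> _) _]/(_ + _) -![(- _ : _ -> _) _]/(- _).
  have := near fg0 h; rewrite /= /cst (nbhs_singleton fg) => -> //.
have dg : 'd g p = 'd f p :> (V -> W).
  by apply: diff_unique => //; exact: diff_continuous.
apply: DiffDef => //; apply/diff_locallyP; rewrite dg; split => //.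
exact: diff_continuous.
Unshelve. all: by end_near. Qed.

Lemma is_diff_ext V W (f g df dg : V -> W) (p : V) :
  f =1 g -> df =1 dg -> is_diff p f df -> is_diff p g dg.
Proof. by move=> /funext-> /funext->. Qed.

Lemma near_eq_differentiable V W (f g : V -> W) (p : V) :
  (\forall q \near p, f q = g q) -> differentiable f p -> differentiable g p.
Proof.
by move=> fg /differentiableP dfp; have [] := near_eq_is_diff fg dfp.
Qed.

Lemma is_diff_derive V W (f df : V -> W) p v : is_diff p f df -> 'D_v f p = df v.
Proof. by move=> [fp <-]; rewrite deriveE. Qed.

Lemma is_diffP V W (f df : V -> W) p :
  differentiable f p -> (forall v, 'D_v f p = df v) -> is_diff p f df.
Proof.
by move=> fp dfE; apply: DiffDef => //; apply/funext => v; rewrite -deriveE.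
Qed.

Lemma is_diff_derivable1 W (f : R -> W) t :
  differentiable f t -> is_diff t f (fun h => h *: derive1 f t).
Proof.
move=> ft; apply: is_diffP => // v.
by rewrite derive1E' // deriveE // -linearZ /= [v *: 1]mulr1.
Qed.

Lemma scaler_is_bilinear W :
  bilinear_for (GRing.Scale.Law.clone _ _ *:%R _)
    (GRing.Scale.Law.clone _ _ *:%R _) (@GRing.scale R W).
Proof.
split=> [v|k] a x y /=; first by rewrite scalerDl scalerA.
by rewrite scalerDr !scalerA mulrC.
Qed.

Lemma is_diff_scale V W (k : V -> R) (f : V -> W) dk df p :
  is_diff p k dk -> is_diff p f df ->
  is_diff p (fun q => k q *: f q) (fun h => dk h *: f p + k p *: df h).
Proof.
move=> kp fp.
pose sM := bilinear_isBilinear.Build R R W W _ _ _ (scaler_is_bilinear W).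
pose s : {bilinear R -> W -> W} := HB.pack (@GRing.scale R W) sM.
have sc : continuous (fun z : R * W => s z.1 z.2) by move=> z; apply: scale_continuous.
have sd : is_diff (k p, f p) (fun z : R * W => s z.1 z.2)
    (fun z => k p *: z.2 + z.1 *: f p).
  by apply: DiffDef; [exact: differentiable_bilin|rewrite diff_bilin].
have := is_diff_comp (is_diff_pair kp fp) sd.
by move=> H; apply: (is_diff_eq H); apply/funext => h /=; rewrite addrC.
Qed.

Lemma is_diff_sum V W (I : Type) (r : seq I) (f df : I -> V -> W) p :
  (forall i, is_diff p (f i) (df i)) ->
  is_diff p (fun q => \sum_(i <- r) f i q) (fun h => \sum_(i <- r) df i h).
Proof.
move=> fp; elim: r => [|i r IH].
  apply: near_eq_is_diff (is_diff_eq (is_diff_cst 0 p) _).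
    by apply: nearW => q; rewrite big_nil.
  by apply/funext => h; rewrite big_nil.
apply: near_eq_is_diff (is_diff_eq (is_diffD (fp i) IH) _).
  by apply: nearW => q; rewrite big_cons.
by apply/funext => h; rewrite big_cons.
Qed.

Lemma is_diff_linear V X W (l : {linear X -> W}) (f df : V -> X) p :
  continuous l -> is_diff p f df -> is_diff p (l \o f) (l \o df).
Proof.
move=> lc fp; apply: is_diff_comp fp _.
by apply: DiffDef; [exact: linear_differentiable|rewrite diff_lin].
Qed.

Lemma is_diff_coord V m n (f df : V -> 'M[R]_(m, n)) p i j :
  is_diff p f df -> is_diff p (fun q => f q i j) (fun h => df h i j).
Proof.
have @l : {linear 'M[R]_(m, n) -> R}.
  by exists (fun N : 'M[R]_(_, _) => N i j); do 2![eexists]; do ?[constructor];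
     rewrite ?mxE// => ? *; rewrite ?mxE//; move=> ?; rewrite !mxE.
by move=> fp; apply: (is_diff_linear (l := l)) fp; exact: coord_continuous.
Qed.

Lemma is_diff_mx V m n (f df : V -> 'M[R]_(m, n)) p :
  (forall i j, is_diff p (fun q => f q i j) (fun h => df h i j)) -> is_diff p f df.
Proof.
move=> fp.
have := is_diff_sum (index_enum 'I_m) (fun i => is_diff_sum (index_enum 'I_n)
  (fun j => is_diff_scale (fp i j) (is_diff_cst (delta_mx i j) p))).
move=> H; apply: near_eq_is_diff (is_diff_eq H _); first by apply: nearW => q; rewrite [RHS]matrix_sum_delta.
apply/funext => h; rewrite [RHS]matrix_sum_delta.
apply: eq_bigr => i _; apply: eq_bigr => j _.
by rewrite [X in _ + X]scaler0 addr0.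
Qed.

Lemma linear_rV_sum W n (l : 'rV[R]_n -> W) :
  (forall a u v, l (a *: u + v) = a *: l u + l v) ->
  forall u, l u = \sum_(i < n) u 0 i *: l (delta_mx 0 i).
Proof.
move=> lP; pose lM := GRing.isLinear.Build _ _ _ _ l lP.
pose L : {linear 'rV[R]_n -> W} := HB.pack l lM.
move=> u; rewrite -[l]/(L : _ -> _) {1}[u]row_sum_delta linear_sum.
by apply: eq_bigr => i _; rewrite linearZ.
Qed.

(* The finite dimension of the fibre makes the partial differentials suffice. *)
Lemma is_diff_linear_family V W n (A : V -> 'rV[R]_n -> W) (dA : V -> 'rV[R]_n -> W)
    (u du : V -> 'rV[R]_n) p :
  (\forall q \near p, forall a v w, A q (a *: v + w) = a *: A q v + A q w) ->
  (forall v, is_diff p (A ^~ v) (dA ^~ v)) -> is_diff p u du ->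
  is_diff p (fun q => A q (u q)) (fun h => dA h (u p) + A p (du h)).
Proof.
move=> lA Ap up.
(* [dA h] is the derivative in direction [h] of a family linear near [p], hence linear; this folds
   the coordinate sum back into [dA h (u p)] at the end. *)
have dAlin h a v w : dA h (a *: v + w) = a *: dA h v + dA h w.
  rewrite -!(is_diff_derive h (Ap _)).
  rewrite (near_eq_derive (g := a \*: (A ^~ v) + (A ^~ w))).
    rewrite deriveD; last first.
    - exact/diff_derivable/(@ex_diff _ _ _ _ _ _ _ (Ap w)).
    - apply/diff_derivable/differentiableZ; exact/(@ex_diff _ _ _ _ _ _ _ (Ap v)).
    rewrite deriveZ //; apply/diff_derivable; exact/(@ex_diff _ _ _ _ _ _ _ (Ap v)).
  by apply: filter_app lA; apply: nearW => q; apply.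
have := is_diff_sum (index_enum 'I_n)
  (fun i => is_diff_scale (is_diff_coord 0 i up) (Ap (delta_mx 0 i))).
move=> H; apply: near_eq_is_diff (is_diff_eq H _).
  by apply: filter_app lA; apply: nearW => q lq; rewrite [RHS]linear_rV_sum.
apply/funext => h; rewrite big_split /= addrC.
by rewrite -(linear_rV_sum (nbhs_singleton lA)) -(linear_rV_sum (dAlin h)).
Qed.

End Differentiation.

(** * Symmetry of second derivatives *)

Section Schwarz.
Context {R : realType}.
Implicit Types V W : normedModType R.

Lemma is_derive_line V W (f : V -> W) (q u : V) (a : R) :
  differentiable f (q + a *: u) ->
  is_derive a 1 (fun b : R => f (q + b *: u)) ('D_u f (q + a *: u)).
Proof.
move=> /differentiableP fq.
have lq : is_diff a (fun b : R => q + b *: u) (fun b : R => b *: u).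
  have H := is_diffD (is_diff_cst q a) (is_diff_scalel a u).
  by apply: (is_diff_eq H); apply/funext => b; rewrite [LHS]add0r.
have H := is_diff_comp lq fq.
split; first exact: diff_derivable.
by rewrite (is_diff_derive (1 : R) H) /= scale1r deriveE.
Qed.

(** The second difference over the parallelogram with sides [s *: u] and [s *: v]: the mean value
    theorem is applied along [u] to the difference of [f] on two opposite sides, then along [v] to
    ['D_u f]. *)
Lemma mean_value_square V (f : V -> R) (U : set V) (p u v : V) (s : R) :
  0 < s -> (forall a b : R, 0 <= a <= s -> 0 <= b <= s -> U (p + a *: u + b *: v)) ->
  (forall q, U q -> differentiable f q) ->
  (forall q, U q -> differentiable ('D_u f) q) ->
  exists a b : R, [/\ 0 <= a <= s, 0 <= b <= s &
    f (p + s *: u + s *: v) - f (p + s *: u) - f (p + s *: v) + f p =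
    s * s * 'D_v ('D_u f) (p + a *: u + b *: v)].
Proof.
move=> s0 sU fU DfU.
have sle : 0 <= s <= s by rewrite (ltW s0) lexx.
have z0 : 0 <= (0 : R) <= s by rewrite lexx (ltW s0).
have U0 a : 0 <= a <= s -> U (p + a *: u).
  by move=> as0; have := sU a 0 as0 z0; rewrite scale0r addr0.
have Us a : 0 <= a <= s -> U (p + s *: v + a *: u).
  by move=> as0; have := sU a s as0 sle; rewrite addrAC.
pose F (a : R) := f (p + s *: v + a *: u) - f (p + a *: u).
have Fd (a : R) : 0 <= a <= s ->
    is_derive a 1 F ('D_u f (p + s *: v + a *: u) - 'D_u f (p + a *: u)).
  by move=> as0; apply: is_deriveB; apply: is_derive_line; apply: fU; auto.
have Fd' (a : R) : a \in `]0, s[ ->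
    is_derive a 1 F ('D_u f (p + s *: v + a *: u) - 'D_u f (p + a *: u)).
  by rewrite in_itv /= => /andP[/ltW a0 /ltW as0]; apply: Fd; rewrite a0 as0.
have Fc : {within `[0, s], continuous F}.
  apply: derivable_within_continuous => a.
  by rewrite in_itv /= => as0; have [] := Fd a as0.
have [a] := MVT_segment (ltW s0) Fd' Fc.
rewrite in_itv /= subr0 => as0 Fs.
have Gd (b : R) : 0 <= b <= s -> is_derive b 1
    (fun b : R => 'D_u f (p + a *: u + b *: v)) ('D_v ('D_u f) (p + a *: u + b *: v)).
  by move=> bs0; apply: is_derive_line; apply: DfU; apply: sU.
have Gd' (b : R) : b \in `]0, s[ -> is_derive b 1
    (fun b : R => 'D_u f (p + a *: u + b *: v)) ('D_v ('D_u f) (p + a *: u + b *: v)).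
  by rewrite in_itv /= => /andP[/ltW b0 /ltW bs0]; apply: Gd; rewrite b0 bs0.
have Gc : {within `[0, s], continuous (fun b : R => 'D_u f (p + a *: u + b *: v))}.
  apply: derivable_within_continuous => b.
  by rewrite in_itv /= => bs0; have [] := Gd b bs0.
have [b] := MVT_segment (ltW s0) Gd' Gc.
rewrite in_itv /= subr0 scale0r addr0 => bs0 Gs.
exists a, b; split => //.
move: Fs; rewrite /F scale0r !addr0 ![p + s *: v + _]addrAC Gs.
by move=> Fs; rewrite mulrC mulrA -Fs; ring.
Qed.

(** The second difference is symmetric in [u] and [v], so the two mixed derivatives take a common
    value at two points of any small parallelogram; continuity at [p] brings both points back to
    [p]. *)
Theorem symmetry_second_derivative V (f : V -> R) (U : set V) (p u v : V) :
  open U -> U p -> (forall q, U q -> differentiable f q) ->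
  (forall q, U q -> differentiable ('D_u f) q) ->
  (forall q, U q -> differentiable ('D_v f) q) ->
  {for p, continuous ('D_v ('D_u f))} -> {for p, continuous ('D_u ('D_v f))} ->
  'D_v ('D_u f) p = 'D_u ('D_v f) p.
Proof.
move=> oU Up fU uU vU cuv cvu.
apply/eqP; rewrite -subr_eq0 -normr_le0; apply/ler_addgt0Pr => e e0; rewrite add0r.
have e20 : 0 < e / 2 by rewrite divr_gt0.
have /cvgrPdist_lt /(_ _ e20) Huv := cuv.
have /cvgrPdist_lt /(_ _ e20) Hvu := cvu.
have near3 (P Q T : set V) : nbhs p P -> nbhs p Q -> nbhs p T ->
    nbhs p [set q | [/\ P q, Q q & T q]].
  by move=> nP nQ nT; apply: (@filterS3 _ (nbhs p) _ P Q T) => // q *; split.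
have Hp := near3 _ _ _ (open_nbhs_nbhs (conj oU Up)) Huv Hvu.
have /nbhs_ballP[r /= r0 Hr] := Hp.
(* The factor [n] keeps the whole parallelogram within r / 2 of [p]; the summand 1 keeps it nonzero
   when [u] and [v] both vanish. *)
set n := `|u| + `|v| + 1.
have n0 : 0 < n by rewrite ltr_pwDr // addr_ge0.
set s := r / 2 / n.
have s0 : 0 < s by rewrite !divr_gt0.
have sB (a b : R) : 0 <= a <= s -> 0 <= b <= s -> ball p r (p + a *: u + b *: v).
  move=> /andP[a0 as0] /andP[b0 bs0].
  rewrite -ball_normE /ball_ /= -addrA opprD addNKr normrN.
  apply: le_lt_trans (ler_normD _ _) _; rewrite !normrZ !ger0_norm //.
  apply: (@le_lt_trans _ _ (s * n)).
    rewrite /n !mulrDr -[leLHS]addr0; apply: lerD; last by rewrite mulr_ge0 // ltW.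
    by apply: lerD; apply: ler_wpM2r.
  by rewrite /s divfK ?gt_eqF // ltr_pdivrMr // ltr_pMr // ltr1n.
pose B := [set q | ball p r q].
have BU q : B q -> U q by move=> /Hr[].
have [a [b [a0 b0 E1]]] := mean_value_square s0 sB
  (fun q Bq => fU q (BU q Bq)) (fun q Bq => uU q (BU q Bq)).
have sB' (a' b' : R) : 0 <= a' <= s -> 0 <= b' <= s -> B (p + a' *: v + b' *: u).
  by move=> *; rewrite addrAC; apply: sB.
have [a' [b' [a0' b0' E2]]] := mean_value_square s0 sB'
  (fun q Bq => fU q (BU q Bq)) (fun q Bq => vU q (BU q Bq)).
have E : 'D_v ('D_u f) (p + a *: u + b *: v) = 'D_u ('D_v f) (p + a' *: v + b' *: u).
  apply: (@mulfI _ (s * s)); first by rewrite mulf_neq0 // gt_eqF.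
  apply: etrans (esym E1) (etrans _ E2); rewrite [p + s *: v + s *: u]addrAC.
  move: (f _) (f _) (f _) (f _) => x1 x2 x3 x4; ring.
have [_ H1 _] := Hr _ (sB _ _ a0 b0).
have [_ _ H2] := Hr _ (sB' _ _ a0' b0').
rewrite -(subrK ('D_v ('D_u f) (p + a *: u + b *: v)) ('D_v ('D_u f) p)) -addrA.
rewrite {2}E (splitr e); apply: le_trans (ler_normD _ _) _.
apply: (lerD (ltW H1)); rewrite distrC; exact: ltW H2.
Qed.

End Schwarz.

(** * Lifts of curves through immersions *)

Section ImplicitDerivative.
Context {R : realType}.

(* The error term is controlled by the increment of the unknown [a] itself. *)
Lemma is_diff_of_approx (V : normedModType R) (a q dq : R -> V) t :
  is_diff t q dq ->
  (forall e : R, 0 < e -> \forall s \near t,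
     `|(a s - a t) - (q s - q t)| <= e * `|a s - a t|) ->
  is_diff t a dq.
Proof.
move=> qt H.
have /diff_locallyP[_ /eqaddoP qo] := @ex_diff _ _ _ _ _ _ _ qt.
have dqc : continuous ('d q t) by exact: diff_continuous.
have [k k0 kP] := linear_lipschitz dqc.
have ao : a \o shift t = cst (a t) + 'd q t +o_ 0 id.
  apply/eqaddoP => e e0.
  (* With [e1 <= 1/2] the increment of [a] is at most twice that of [q], itself at most
     [(k + 1) * |h|]; so [K] is a Lipschitz bound for [a] at [t], and [e1 * K <= e / 2] leaves the
     other half of [e] to the remainder of [q]. *)
  set K := 2 * (k + 1).
  have K0 : 0 < K by rewrite mulr_gt0 // addr_gt0.
  pose e1 := Num.min 2^-1 (e / 2 / K).
  have e10 : 0 < e1 by rewrite lt_min invr_gt0 ltr0n /= !divr_gt0.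
  have e2 : e1 * K <= e / 2 by rewrite -ler_pdivlMr // ge_min lexx orbT.
  have e12 : e1 <= 2^-1 by rewrite ge_min lexx.
  have := qo _ (ltr01); have := qo (e / 2); rewrite divr_gt0 // => /(_ isT) qe q1.
  have := H _ e10; rewrite (near_shift 0 t) => He.
  have qoE (e' : R) :
      (\forall h \near 0, `|(q \o shift t - (cst (q t) + 'd q t)) h| <= e' * `|h|) ->
      \forall h \near 0, `|q (h + t) - q t - 'd q t h| <= e' * `|h|.
    apply: filter_app; near=> h.
    rewrite -![(_ + _ : _ -> _) _]/(_ + _) -![(- _ : _ -> _) _]/(- _) /=.
    by rewrite /cst opprD addrA.
  have He' : \forall h \near 0, `|(a (h + t) - a t) - (q (h + t) - q t)| <=
      e1 * `|a (h + t) - a t|.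
    by apply: filter_app He; near=> x => /=; rewrite subr0.
  near=> h; rewrite -![(_ + _ : _ -> _) _]/(_ + _) -![(- _ : _ -> _) _]/(- _) /=.
  rewrite /cst opprD addrA.
  have Ah : `|a (h + t) - a t - (q (h + t) - q t)| <= e1 * `|a (h + t) - a t|.
    by near: h; exact: He'.
  have qeh : `|q (h + t) - q t - 'd q t h| <= e / 2 * `|h| by near: h; exact: qoE.
  have q1h : `|q (h + t) - q t - 'd q t h| <= `|h|.
    by rewrite -[leRHS]mul1r; near: h; exact: qoE.
  move: Ah qeh q1h; set A := a (h + t) - a t; set Q := q (h + t) - q t.
  move=> Ah qeh q1h.
  have Qh : `|Q| <= (k + 1) * `|h|.
    rewrite -[Q](subrK ('d q t h)) mulrDl mul1r addrC.
    exact: le_trans (ler_normD _ _) (lerD (kP _) q1h).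
  have AQ : `|A| <= 2 * `|Q|.
    have : `|A| <= `|Q| + 2^-1 * `|A|.
      rewrite -{1}[A](subrK Q) addrC; apply: le_trans (ler_normD _ _) _.
      by rewrite lerD2l; apply: le_trans Ah _; apply: ler_wpM2r.
    lra.
  have Ah' : `|A| <= K * `|h|.
    by apply: le_trans AQ _; rewrite /K -mulrA ler_pM2l.
  rewrite -[A](subrK Q) -addrA (splitr e) mulrDl.
  apply: le_trans (ler_normD _ _) _; apply: lerD => //.
  apply: le_trans Ah _; apply: le_trans (ler_wpM2l (ltW e10) Ah') _.
  by rewrite mulrA; apply: ler_wpM2r.
have dE : 'd a t = 'd q t :> (R -> V) by apply: diff_unique.
apply: DiffDef; last by rewrite dE diff_val.
by apply/diff_locallyP; rewrite dE.
Unshelve. all: by end_near. Qed.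

End ImplicitDerivative.

Section RowSpaces.
Context {R : realType}.
Implicit Types V W : normedModType R.

Lemma is_diff_linear_rV W n (l : 'rV[R]_n -> W) (p : 'rV[R]_n) :
  (forall a u v, l (a *: u + v) = a *: l u + l v) -> is_diff p l l.
Proof.
move=> lP.
have H : is_diff p l (fun h => (fun _ _ => 0) h (id p) + l (id h)).
  apply: (@is_diff_linear_family R _ W n (fun=> l) (fun _ _ => 0) id id p).
  - by apply: (@nearW _ (nbhs p)) => q; exact: lP.
  - by move=> v; exact: is_diff_cst.
by apply: (is_diff_eq H); apply/funext => h; rewrite add0r.
Qed.

Lemma linear_rV_continuous W n (l : 'rV[R]_n -> W) :
  (forall a u v, l (a *: u + v) = a *: l u + l v) -> continuous l.
Proof.
move=> lP p; apply: differentiable_continuous.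
exact: (@ex_diff _ _ _ _ _ _ _ (is_diff_linear_rV p lP)).
Qed.

Lemma is_diff_linear_comp V W n (l : 'rV[R]_n -> W) (f df : V -> 'rV[R]_n) p :
  (forall a u v, l (a *: u + v) = a *: l u + l v) -> is_diff p f df ->
  is_diff p (fun q => l (f q)) (fun h => l (df h)).
Proof. by move=> lP fp; apply: (is_diff_comp fp (is_diff_linear_rV _ lP)). Qed.

Lemma mulmxr_linear_rV n k (B : 'M[R]_(n, k)) (a : R) (u v : 'rV[R]_n) :
  (a *: u + v) *m B = a *: (u *m B) + v *m B.
Proof. by rewrite mulmxDl scalemxAl. Qed.

Lemma mulmx_rV_inj m n (A B : 'M[R]_(m, n)) :
  (forall u : 'rV[R]_m, u *m A = u *m B) -> A = B.
Proof. by move=> AB; apply/row_matrixP => i; rewrite !rowE AB. Qed.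

Lemma jacobian_comp m n k (f : 'rV[R]_m -> 'rV[R]_n) (g : 'rV[R]_n -> 'rV[R]_k) p :
  differentiable f p -> differentiable g (f p) ->
  'J (g \o f) p = 'J f p *m 'J g (f p).
Proof.
move=> fp gp; apply: mulmx_rV_inj => u; rewrite mulmxA.
rewrite -(deriveEjacobian u (differentiable_comp fp gp)).
rewrite -(deriveEjacobian u fp) -(deriveEjacobian _ gp).
by rewrite (deriveE _ (differentiable_comp fp gp)) diff_comp //= !deriveE.
Qed.

Lemma near_eq_jacobian m n (f g : 'rV[R]_m -> 'rV[R]_n) p :
  (\forall q \near p, f q = g q) -> differentiable f p -> 'J f p = 'J g p.
Proof.
move=> fg fp; apply: mulmx_rV_inj => u.
transitivity ('D_u f p); first exact: esym (deriveEjacobian u fp).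
transitivity ('D_u g p); first exact: near_eq_derive.
exact: deriveEjacobian u (near_eq_differentiable fg fp).
Qed.

Lemma jacobian_id n (p : 'rV[R]_n) : 'J id p = 1%:M.
Proof.
by apply: mulmx_rV_inj => u; rewrite -deriveEjacobian ?derive_id ?mulmx1.
Qed.

Lemma lipschitz_linear_rV W n (l : 'rV[R]_n -> W) :
  (forall a u v, l (a *: u + v) = a *: l u + l v) ->
  exists2 k : R, 0 < k & forall x, `|l x| <= k * `|x|.
Proof.
move=> lP; pose lM := GRing.isLinear.Build _ _ _ _ l lP.
pose L : {linear 'rV[R]_n -> W} := HB.pack l lM.
exact: (@linear_lipschitz R _ _ L (linear_rV_continuous lP)).
Qed.

Lemma coord_le_norm n (x : 'rV[R]_n) i : `|x 0 i| <= `|x|.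
Proof.
by rewrite [leRHS]/Num.Def.normr /= mx_normrE; exact: (le_bigmax _ _ (0, i)).
Qed.

(* Where [f] is an immersion, a continuous lift through [f] of a differentiable
   curve is differentiable: no inverse function theorem is needed. *)
Lemma differentiable_immersion_lift d e (f : 'rV[R]_d -> 'rV[R]_e)
    (w : R -> 'rV[R]_d) (z : R -> 'rV[R]_e) t :
  differentiable f (w t) -> row_free ('J f (w t)) ->
  {for t, continuous w} -> (\forall s \near t, f (w s) = z s) ->
  differentiable z t -> differentiable w t.
Proof.
move=> fw /row_freeP[B JB] wt wz /differentiableP zt.
have [k k0 kB] := lipschitz_linear_rV (@mulmxr_linear_rV _ _ B).
(* The curve [z] times [B] approximates [w]: since ['J f (w t) *m B = 1], their increments differ by
   the Taylor remainder of [f] multiplied by [B], which is small relative to the increment of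
   [w]. *)
have qt := is_diff_linear_comp (@mulmxr_linear_rV _ _ B) zt.
have wzt := nbhs_singleton wz.
suff [] : is_diff t w (fun h => 'd z t h *m B) by [].
apply: is_diff_of_approx qt _ => eps eps0.
have ek0 : 0 < eps / k by rewrite divr_gt0.
have /diff_locallyP[_ /eqaddoP /(_ _ ek0) fo0] := fw.
have fo1 : \forall x \near w t,
    `|f x - f (w t) - (x - w t) *m 'J f (w t)| <= eps / k * `|x - w t|.
  rewrite (near_shift 0 (w t)); apply: filter_app fo0; near=> h.
  rewrite -![(_ + _ : _ -> _) _]/(_ + _) -![(- _ : _ -> _) _]/(- _) /= subr0.
  by rewrite /cst opprD addrA addrK -(deriveEjacobian h fw) deriveE.
have fo : \forall s \near t, `|f (w s) - f (w t) - (w s - w t) *m 'J f (w t)| <=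
    eps / k * `|w s - w t| := wt _ fo1.
near=> s.
have fos : `|f (w s) - f (w t) - (w s - w t) *m 'J f (w t)| <= eps / k * `|w s - w t|.
  by near: s.
have -> : z s = f (w s) by apply/esym; near: s.
rewrite -wzt -{1}[w s - w t]mulmx1 -JB mulmxA -!mulmxBl.
apply: le_trans (kB _) _.
by rewrite mulrC -ler_pdivlMr // mulrAC distrC.
Unshelve. all: by end_near. Qed.

(** Meant for the velocity of a lift, which solves a linear system with moving coefficients. The
    increment of [v] differs from that of [(r - A ^~ (v t)) *m B] by [(A t - A s) (v s - v t) *m B],
    which continuity of [A] makes small relative to the increment of [v]. *)
Lemma differentiable_linear_lift d e (A : R -> 'rV[R]_d -> 'rV[R]_e)
    (B : 'M[R]_(e, d)) (v : R -> 'rV[R]_d) (r : R -> 'rV[R]_e) t :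
  (\forall s \near t, forall a u w, A s (a *: u + w) = a *: A s u + A s w) ->
  (forall u, differentiable (A ^~ u) t) -> (forall u, A t u *m B = u) ->
  (\forall s \near t, A s (v s) = r s) -> differentiable r t ->
  differentiable v t.
Proof.
move=> lA At AB vr rt.
have [k k0 kB] := lipschitz_linear_rV (@mulmxr_linear_rV _ _ B).
have ABlin (s : R) (Hs : forall a u w, A s (a *: u + w) = a *: A s u + A s w) u w :
    A s (u - w) = A s u - A s w.
  by rewrite addrC -scaleN1r Hs scaleN1r addrC.
have qt := is_diff_linear_comp (@mulmxr_linear_rV _ _ B)
  (differentiableP (differentiableB rt (At (v t)))).
suff [] : is_diff t v (fun h => 'd (r - A^~ (v t)) t h *m B) by [].
apply: is_diff_of_approx qt _ => eps eps0.
(* Each of the [d] coordinates contributes an error [c], and [k] bounds [B]; the summand 1 keeps the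
   denominator positive for [d = 0]. *)
pose c := eps / k / (d%:R + 1).
have d10 : 0 < d%:R + 1 :> R by rewrite ltr_wpDl // ler0n.
have c0 : 0 < c by rewrite !divr_gt0.
pose P (i : 'I_d) (s : R) : Prop := `|A t (delta_mx 0 i) - A s (delta_mx 0 i)| < c.
have Ac : \forall s \near t, forall i : 'I_d, P i s.
  apply: (@filter_forall R 'I_d P (nbhs t)) => i.
  by have /differentiable_continuous/cvgrPdist_lt/(_ _ c0) := At (delta_mx 0 i).
near=> s.
have lAs : forall a u w, A s (a *: u + w) = a *: A s u + A s w by near: s.
have lAt := nbhs_singleton lA.
rewrite /=.
have -> : r s = A s (v s) by rewrite (near vr s).
rewrite -(nbhs_singleton vr) -!mulmxBl subrr subr0 -ABlin //.
rewrite -{1}(AB (v s - v t)) -mulmxBl; apply: le_trans (kB _) _.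
rewrite mulrC -ler_pdivlMr // mulrAC.
rewrite (linear_rV_sum lAt) (linear_rV_sum lAs) -sumrB.
apply: le_trans (ler_norm_sum _ _ _) _.
apply: (@le_trans _ _ (\sum_(i < d) (c * `|v s - v t|))).
  apply: ler_sum => i _; rewrite -scalerBr normrZ mulrC.
  apply: ler_pM => //; last exact: coord_le_norm.
  by apply: ltW; move: i; near: s.
rewrite sumr_const card_ord -mulr_natl mulrA; apply: ler_wpM2r => //.
by rewrite /c mulrA ler_pdivrMr // mulrC ler_pM2l ?divr_gt0 // lerDl.
Unshelve. all: by end_near. Qed.

End RowSpaces.

(** * Functions of class C^k *)

Section SmoothFunctions.
Context {R : realType}.
Implicit Types (V W X : normedModType R) (k : nat).

Lemma open_near V (U : set V) p : open U -> U p -> \forall q \near p, U q.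
Proof. by move=> oU Up; exact: open_nbhs_nbhs. Qed.

Lemma smooth_on_differentiable V W (U : set V) (f : V -> W) p :
  smooth_on U f -> U p -> differentiable f p.
Proof. by move=> /(_ 1%N)[fU _]; exact: fU. Qed.

Lemma smooth_on_derive V W (U : set V) (f : V -> W) v :
  smooth_on U f -> smooth_on U ('D_v f).
Proof. by move=> fU k; have [_] := fU k.+1; exact. Qed.

Lemma smooth_on_continuous V W (U : set V) (f : V -> W) p :
  smooth_on U f -> U p -> {for p, continuous f}.
Proof. by move=> /(_ 0%N); exact. Qed.

Lemma CkW V W k (U : set V) (f : V -> W) : Ck k.+1 U f -> Ck k U f.
Proof.
elim: k f => [f [fU _] p /fU|k IH f [fU dfU]]; first exact: differentiable_continuous.
by split=> // v; apply: IH.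
Qed.

Lemma Ck_ext V W k (U : set V) (f g : V -> W) :
  open U -> (forall p, U p -> f p = g p) -> Ck k U f -> Ck k U g.
Proof.
move=> oU; elim: k f g => [f g fg fU p Up|k IH f g fg [fU dfU]].
  have fgn : \forall q \near p, f q = g q by apply: filterS (open_near oU Up).
  have gc : g @ p --> f p by apply: cvg_trans (fU p Up); exact: near_eq_cvg.
  by move: gc; rewrite (fg p Up).
have fgn p : U p -> \forall q \near p, f q = g q.
  by move=> Up; apply: filterS (open_near oU Up).
split=> [p Up|v]; first exact: near_eq_differentiable (fgn p Up) (fU p Up).
by apply: IH (dfU v) => p Up; apply: near_eq_derive; exact: fgn.
Qed.

Lemma Ck_subset V W k (U U' : set V) (f : V -> W) :
  U' `<=` U -> Ck k U f -> Ck k U' f.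
Proof.
move=> UU; elim: k f => [f fU p /UU/fU //|k IH f [fU dfU]].
by split=> [p /UU/fU //|v]; exact: IH (dfU v).
Qed.

Lemma Ck_affine V W k (U : set V) (l : {linear V -> W}) (c : W) :
  open U -> continuous l -> Ck k U (fun p => l p + c).
Proof.
move=> oU lc; have lcd p : is_diff p (fun p => l p + c) l.
  have H := is_diffD (@DiffDef _ _ _ _ _ _ _ (linear_differentiable p lc) (diff_lin p lc))
    (is_diff_cst c p).
  by apply: (is_diff_eq H); apply/funext => h; rewrite [LHS]addr0.
have cstk : forall k (w : W), Ck k U (fun=> w).
  elim=> [w p _|j IH w]; first exact: cst_continuous.
  split=> [p _|v]; first exact: differentiable_cst.
  by apply: Ck_ext (IH 0) => // p _; rewrite -[RHS]/('D_v (cst w) p) derive_cst.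
case: k => [p _|k].
  exact: differentiable_continuous (@ex_diff _ _ _ _ _ _ _ (lcd p)).
split=> [p _|v]; first exact: (@ex_diff _ _ _ _ _ _ _ (lcd p)).
by apply: Ck_ext (cstk k (l v)) => // p _; rewrite (is_diff_derive v (lcd p)).
Qed.

Lemma Ck_add V W k (U : set V) (f g : V -> W) : open U ->
  Ck k U f -> Ck k U g -> Ck k U (fun p => f p + g p).
Proof.
move=> oU; elim: k f g => [f g fU gU p Up|k IH f g [fU dfU] [gU dgU]].
  exact: continuousD (fU p Up) (gU p Up).
split=> [p Up|v]; first exact: differentiableD (fU p Up) (gU p Up).
apply: Ck_ext (IH _ _ (dfU v) (dgU v)) => // p Up; apply/esym.
rewrite -[LHS]/('D_v (f + g) p) deriveD //; apply: diff_derivable; auto.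
Qed.

Lemma Ck_scale V W k (U : set V) (a : V -> R) (f : V -> W) : open U ->
  Ck k U a -> Ck k U f -> Ck k U (fun p => a p *: f p).
Proof.
move=> oU; elim: k a f => [a f aU fU p Up|k IH a f aU fU].
  exact: continuousZ (aU p Up) (fU p Up).
have afd p : U p ->
    is_diff p (fun p => a p *: f p) (fun h => 'd a p h *: f p + a p *: 'd f p h).
  move=> Up; apply: is_diff_scale; apply: differentiableP;
  [exact: aU.1|exact: fU.1].
split=> [p Up|v]; first exact: (@ex_diff _ _ _ _ _ _ _ (afd p Up)).
have := Ck_add oU (IH _ _ (aU.2 v) (CkW fU)) (IH _ _ (CkW aU) (fU.2 v)).
apply: Ck_ext => // p Up; rewrite (is_diff_derive v (afd p Up)).
by rewrite !deriveE //; [exact: fU.1|exact: aU.1].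
Qed.

Lemma Ck_sum V W k (U : set V) (I : Type) (r : seq I) (f : I -> V -> W) : open U ->
  (forall i, Ck k U (f i)) -> Ck k U (fun p => \sum_(i <- r) f i p).
Proof.
move=> oU fU; elim: r => [|i r IH].
  have := @Ck_affine V W k U (@GRing.null_fun V W) 0 oU (@cst_continuous _ _ 0).
  by apply: Ck_ext => // p _; rewrite big_nil addr0.
by apply: Ck_ext (Ck_add oU (fU i) IH) => // p _; rewrite big_cons.
Qed.

Lemma Ck_linear_comp V W X k (U : set V) (l : {linear W -> X}) (f : V -> W) :
  open U -> continuous l -> Ck k U f -> Ck k U (fun p => l (f p)).
Proof.
move=> oU lc; elim: k f => [f fU p Up|k IH f [fU dfU]].
  exact: (continuous_comp (fU p Up) (lc _)).
have lf p : U p -> is_diff p (fun p => l (f p)) (fun h => l ('d f p h)).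
  move=> Up; exact: (is_diff_linear lc (differentiableP (fU p Up))).
split=> [p Up|v]; first exact: (@ex_diff _ _ _ _ _ _ _ (lf p Up)).
apply: Ck_ext (IH _ (dfU v)) => // p Up.
by rewrite (is_diff_derive v (lf p Up)) deriveE //; exact: fU.
Qed.

Lemma Ck_coord V k p q (U : set V) (f : V -> 'M[R]_(p, q)) a b :
  open U -> Ck k U f -> Ck k U (fun z => f z a b).
Proof.
move=> oU fU.
have @l : {linear 'M[R]_(p, q) -> R}.
  by exists (fun N : 'M[R]_(_, _) => N a b); do 2![eexists]; do ?[constructor];
     rewrite ?mxE// => ? *; rewrite ?mxE//; move=> ?; rewrite !mxE.
by apply: (@Ck_linear_comp V _ _ k U l f) => //; exact: coord_continuous.
Qed.

(** For an affine inner map the derivative along [v] is the derivative of [f] along the constant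
    vector [l v], composed with the same map, so the induction needs no chain rule of higher
    order. *)
Lemma Ck_comp_affine V W X k (U : set W) (l : {linear V -> W}) (c : W) (f : W -> X) :
  open U -> continuous l -> Ck k U f ->
  Ck k [set p | U (l p + c)] (fun p => f (l p + c)).
Proof.
move=> oU lc.
have lcd p : is_diff p (fun p => l p + c) l.
  have H := is_diffD (@DiffDef _ _ _ _ _ _ _ (linear_differentiable p lc) (diff_lin p lc))
    (is_diff_cst c p).
  by apply: (is_diff_eq H); apply/funext => h; rewrite [LHS]addr0.
have lcc : continuous (fun p => l p + c).
  move=> p; exact: differentiable_continuous (@ex_diff _ _ _ _ _ _ _ (lcd p)).
have oV : open [set p | U (l p + c)].
  by apply: (@open_comp _ _ (fun p => l p + c)) => // p _; exact: lcc.
elim: k f => [f fU p Up|k IH f [fU dfU]].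
  exact: (continuous_comp (lcc p) (fU _ Up)).
have fd p : U (l p + c) ->
    is_diff p (fun p => f (l p + c)) (fun h => 'd f (l p + c) (l h)).
  move=> Up; exact: (is_diff_comp (lcd p) (differentiableP (fU _ Up))).
split=> [p Up|v]; first exact: (@ex_diff _ _ _ _ _ _ _ (fd p Up)).
apply: Ck_ext (IH _ (dfU (l v))) => // p Up.
by rewrite (is_diff_derive v (fd p Up)) deriveE //; exact: fU.
Qed.

(** The derivative is expressed by powers of the function itself, so that [Ck_rsqrt] can go by
    induction on [k] with products only. *)
Lemma is_diff_rsqrt V (f df : V -> R) p : 0 < f p -> is_diff p f df ->
  is_diff p (fun q => (Num.sqrt (f q))^-1)
    (fun h => - 2^-1 * ((Num.sqrt (f p))^-1 ^+ 3 * df h)).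
Proof.
move=> f0 fp.
have s0 : Num.sqrt (f p) != 0 by rewrite gt_eqF // sqrtr_gt0.
have sd := is_derive1_sqrt f0.
have sD : differentiable (@Num.sqrt R) (f p).
  by apply/derivable1_diffP; exact: (@ex_derive _ _ _ _ _ _ _ sd).
have sq : is_diff (f p) (@Num.sqrt R) (fun h => h *: (2 * Num.sqrt (f p))^-1).
  have := is_diff_derivable1 sD.
  by rewrite derive1E (@derive_val _ _ _ _ _ _ _ sd).
have H := is_diff_comp fp sq.
apply: DiffDef; first exact: differentiableV (@ex_diff _ _ _ _ _ _ _ H) s0.
rewrite (diffV (@ex_diff _ _ _ _ _ _ _ H) s0) (@diff_val _ _ _ _ _ _ _ H) /=.
apply/funext => h /=; rewrite /GRing.scale /=; field.
by rewrite s0.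
Qed.

Lemma Ck_rsqrt V k (U : set V) (f : V -> R) : open U ->
  (forall p, U p -> 0 < f p) -> Ck k U f ->
  Ck k U (fun p => (Num.sqrt (f p))^-1).
Proof.
move=> oU f0; elim: k => [fU p Up|k IH fU].
  apply: continuousV; first by rewrite gt_eqF // sqrtr_gt0 f0.
  exact: (continuous_comp (fU p Up) (@sqrt_continuous R _)).
have fd p : U p -> _ := fun Up => is_diff_rsqrt (f0 p Up) (differentiableP (fU.1 p Up)).
split=> [p Up|v]; first exact: (@ex_diff _ _ _ _ _ _ _ (fd p Up)).
have rU := IH (CkW fU).
have H := Ck_scale oU rU (Ck_scale oU rU (Ck_scale oU rU (fU.2 v))).
have cU := @Ck_affine V R k U (@GRing.null_fun V R) (- 2^-1) oU (@cst_continuous _ _ 0).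
apply: Ck_ext (Ck_scale oU cU H) => // p Up.
rewrite (is_diff_derive v (fd p Up)) deriveE ?add0r; last exact: fU.1.
by rewrite /GRing.scale /= !exprS expr0 mulr1 !mulrA.
Qed.

End SmoothFunctions.

(** * Bilinear expressions with moving base point and arguments *)

Section Families.
Context {R : realType}.
Implicit Types V W X : normedModType R.

Lemma is_diff_bilinear_family V W n k (B dB : V -> 'rV[R]_n -> 'rV[R]_k -> W)
    (u du : V -> 'rV[R]_n) (v dv : V -> 'rV[R]_k) (p : V) :
  (\forall q \near p, forall b a u u', B q (a *: u + u') b = a *: B q u b + B q u' b) ->
  (\forall q \near p, forall b a v v', B q b (a *: v + v') = a *: B q b v + B q b v') ->
  (forall a b, is_diff p (fun q => B q a b) (fun h => dB h a b)) ->
  is_diff p u du -> is_diff p v dv ->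
  is_diff p (fun q => B q (u q) (v q))
    (fun h => dB h (u p) (v p) + B p (du h) (v p) + B p (u p) (dv h)).
Proof.
move=> lB rB Bp up vp.
have inner a : is_diff p (fun q => B q a (v q))
    (fun h => dB h a (v p) + B p a (dv h)).
  apply: (@is_diff_linear_family R V W k (fun q => B q a) (fun h => dB h a)) => //.
  by apply: filterS rB => q; apply.
have outer : is_diff p (fun q => B q (u q) (v q))
    (fun h => (dB h (u p) (v p) + B p (u p) (dv h)) + B p (du h) (v p)).
  apply: (@is_diff_linear_family R V W n (fun q a => B q a (v q))
    (fun h a => dB h a (v p) + B p a (dv h))) => //.
  by apply: filterS lB => q lBq a b c; apply: lBq.
by apply: (is_diff_eq outer); apply/funext => h; rewrite addrAC.
Qed.

Lemma is_diff_bilinear_pullback V X W n k (U : set X)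
    (G : X -> 'rV[R]_n -> 'rV[R]_k -> W) (x dx : V -> X)
    (u du : V -> 'rV[R]_n) (v dv : V -> 'rV[R]_k) (p : V) :
  open U ->
  (forall y, U y -> forall b a u u', G y (a *: u + u') b = a *: G y u b + G y u' b) ->
  (forall y, U y -> forall b a v v', G y b (a *: v + v') = a *: G y b v + G y b v') ->
  (forall a b, differentiable (fun y => G y a b) (x p)) ->
  U (x p) -> is_diff p x dx -> is_diff p u du -> is_diff p v dv ->
  is_diff p (fun q => G (x q) (u q) (v q))
    (fun h => 'D_(dx h) (fun y => G y (u p) (v p)) (x p)
              + G (x p) (du h) (v p) + G (x p) (u p) (dv h)).
Proof.
move=> oU lG rG Gd Up xp up vp.
have Ux : \forall q \near p, U (x q).
  have xc : {for p, continuous x}.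
    exact: differentiable_continuous (@ex_diff _ _ _ _ _ _ _ xp).
  exact: (xc _ (open_near oU Up)).
apply: (@is_diff_bilinear_family V W n k (fun q => G (x q))
  (fun h a b => 'D_(dx h) (fun y => G y a b) (x p))) => //.
- by apply: filterS Ux => q Uq; apply: lG.
- by apply: filterS Ux => q Uq; apply: rG.
move=> a b; have H := is_diff_comp xp (differentiableP (Gd a b)).
by apply: (is_diff_eq H); apply/funext => h; rewrite /= deriveE.
Qed.

Lemma smooth_derive_sym V m n (U : set V) (f : V -> 'M[R]_(m, n)) p u v :
  open U -> U p -> smooth_on U f -> 'D_v ('D_u f) p = 'D_u ('D_v f) p.
Proof.
move=> oU Up fU; apply/matrixP => i j.
pose fij (q : V) : R := f q i j.
have fijU : smooth_on U fij.
  by move=> k; exact: Ck_coord oU (fU k).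
have coord a b : ('D_b ('D_a f) p) i j = 'D_b ('D_a fij) p.
  rewrite derive_mx ?mxE; last first.
    exact/diff_derivable/(smooth_on_differentiable (smooth_on_derive a fU) Up).
  apply: near_eq_derive; apply: filterS (open_near oU Up) => q Uq.
  by rewrite derive_mx ?mxE //; exact/diff_derivable/(smooth_on_differentiable fU Uq).
transitivity ('D_v ('D_u fij) p); first exact: coord.
transitivity ('D_u ('D_v fij) p); last exact: (esym (coord _ _)).
apply: (@symmetry_second_derivative R V fij U p u v oU Up).
- by move=> q; exact: smooth_on_differentiable.
- by move=> q; exact: smooth_on_differentiable (smooth_on_derive u fijU).
- by move=> q; exact: smooth_on_differentiable (smooth_on_derive v fijU).
- exact: smooth_on_continuous (smooth_on_derive v (smooth_on_derive u fijU)) Up.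
- exact: smooth_on_continuous (smooth_on_derive u (smooth_on_derive v fijU)) Up.
Qed.

End Families.

Lemma cimg_open {R : realType} {d : nat} (M : atlas R d) (i : chart M) :
  smooth_manifold M -> open (cimg i).
Proof. by move=> Mm; have := @open_overlap _ _ _ Mm i i; rewrite setIid. Qed.

(** * Para-Kahler-Norden geometry in a chart *)

Section LocalGeometry.
Context {R : realType} {m : nat} {M : atlas R m.*2}.
Context {g : form_field M} {nabla : conn_field M} {phi : endo_field M}.
Hypothesis pkn : para_kahler_norden g nabla phi.
Variable i : chart M.
Notation n := m.*2.

Let gR := pkn_metric pkn.
Let lc := pkn_levi_civita pkn.
Let cn := lc_connection lc.
Let Co : open (cimg i) := cimg_open (i := i) (pkn_manifold pkn).

Lemma metric_linearr x : cimg i x -> forall u (a : R) v v',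
  g i x u (a *: v + v') = a * g i x u v + g i x u v'.
Proof.
by move=> Cx u a v v'; rewrite !(Defs.metric_sym gR Cx u) (metric_linear gR).
Qed.

Lemma metricDl x u u' v : cimg i x -> g i x (u + u') v = g i x u v + g i x u' v.
Proof. by move=> Cx; have := metric_linear gR Cx v 1 u u'; rewrite scale1r mul1r. Qed.

Lemma metric0l x v : cimg i x -> g i x 0 v = 0.
Proof.
move=> Cx; have := metric_linear gR Cx v (-1) 0 0.
by rewrite scaler0 addr0 mulN1r addNr.
Qed.

Lemma metricZl x a u v : cimg i x -> g i x (a *: u) v = a * g i x u v.
Proof. by move=> Cx; have := metric_linear gR Cx v a u 0; rewrite !addr0 metric0l // addr0. Qed.

Lemma metricBl x u u' v : cimg i x -> g i x (u - u') v = g i x u v - g i x u' v.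
Proof. by move=> Cx; rewrite metricDl // -scaleN1r metricZl // mulN1r. Qed.

Lemma metric0r x u : cimg i x -> g i x u 0 = 0.
Proof. by move=> Cx; rewrite (Defs.metric_sym gR Cx) metric0l. Qed.

Lemma conn0l x v : cimg i x -> nabla i x 0 v = 0.
Proof.
move=> Cx; have := conn_linearl cn Cx v (-1) 0 0.
by rewrite scaler0 addr0 scaleN1r addNr.
Qed.

Lemma conn0r x u : cimg i x -> nabla i x u 0 = 0.
Proof. by move=> Cx; rewrite (lc_torsion_free lc Cx) conn0l. Qed.

Lemma vpart_linear z a u v : cimg i (lsubmx z) ->
  vpart nabla i z (a *: u + v) = a *: vpart nabla i z u + vpart nabla i z v.
Proof.
move=> Cz; rewrite /vpart !linearP /= (conn_linearl cn Cz) scalerDr.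
by rewrite addrACA.
Qed.

Lemma vpartD z u v : cimg i (lsubmx z) ->
  vpart nabla i z (u + v) = vpart nabla i z u + vpart nabla i z v.
Proof. by move=> Cz; have := vpart_linear 1 u v Cz; rewrite !scale1r. Qed.

Lemma vpartB z u v : cimg i (lsubmx z) ->
  vpart nabla i z (u - v) = vpart nabla i z u - vpart nabla i z v.
Proof. by move=> Cz; have := vpart_linear (-1) v u Cz; rewrite !scaleN1r !(addrC (- _)). Qed.

Section Differentials.
Context {V : normedModType R}.
Variables (x dx : V -> 'rV[R]_n) (p : V).
Hypotheses (Cx : cimg i (x p)) (xp : is_diff p x dx).
Variables (u du v dv : V -> 'rV[R]_n).
Hypotheses (up : is_diff p u du) (vp : is_diff p v dv).

(* Metric compatibility and [pkn_parallel] turn the derivatives of g and phi into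
   covariant derivatives of their arguments. *)
Lemma is_diff_metric : is_diff p (fun q => g i (x q) (u q) (v q))
  (fun h => g i (x p) (du h + nabla i (x p) (dx h) (u p)) (v p)
            + g i (x p) (u p) (dv h + nabla i (x p) (dx h) (v p))).
Proof.
have H := @is_diff_bilinear_pullback R V _ R^o n n (cimg i) (g i) x dx u du v dv p Co.
have {}H := H (fun y Cy b a u u' => metric_linear gR Cy b a u u')
  (fun y Cy b a v v' => metric_linearr Cy b a v v')
  (fun a b => smooth_on_differentiable (metric_smooth gR i a b) Cx) Cx xp up vp.
apply: (is_diff_eq H); apply/funext => h.
rewrite (lc_metric lc Cx) metricDl // ![g i (x p) (u p) (_ + _)](Defs.metric_sym gR Cx).
rewrite metricDl // ![g i (x p) _ (u p)](Defs.metric_sym gR Cx); ring.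
Qed.

(** The subtracted Christoffel term is kept apart on purpose: it cancels the one added by
    [is_diff_metric] when [u *m phi] is an argument of the metric. *)
Lemma is_diff_endo : is_diff p (fun q => u q *m phi i (x q))
  (fun h => (du h + nabla i (x p) (dx h) (u p)) *m phi i (x p)
            - nabla i (x p) (dx h) (u p *m phi i (x p))).
Proof.
have phid : differentiable (phi i) (x p).
  exact: smooth_on_differentiable (endo_smooth (pkn_tensor pkn) i) Cx.
have lind (a : 'rV[R]_n) : is_diff (x p) (fun y => a *m phi i y)
    (fun h => 'D_h (fun y => a *m phi i y) (x p)).
  suff ad : differentiable (fun y => a *m phi i y) (x p) by exact: is_diffP.
  have H : is_diff (x p) (fun y => a *m phi i y) (fun h => a *m 'd (phi i) (x p) h).
    apply: is_diff_mx => k l.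
    have H := is_diff_sum (index_enum 'I_n) (fun j =>
       is_diffZ (a k j) (is_diff_coord j l (differentiableP phid))).
    by apply: is_diff_ext H => h; rewrite [RHS]mxE.
  exact: (@ex_diff _ _ _ _ _ _ _ H).
have H : is_diff p (fun q => u q *m phi i (x q))
    (fun h => 'D_(dx h) (fun y => u p *m phi i y) (x p) + du h *m phi i (x p)).
  apply: (@is_diff_linear_family R V _ n (fun q a => a *m phi i (x q))
    (fun h a => 'D_(dx h) (fun y => a *m phi i y) (x p))) => //.
    by apply: nearW => q a b c; rewrite mulmxDl scalemxAl.
  by move=> a; exact: is_diff_comp xp (lind a).
apply: (is_diff_eq H); apply/funext => h.
have /eqP := pkn_parallel pkn Cx (dx h) (u p).
by rewrite subr_eq0 => /eqP E; rewrite mulmxDl -E addrA addrK addrC.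
Qed.

Lemma is_diff_conn : is_diff p (fun q => nabla i (x q) (u q) (v q))
  (fun h => 'D_(dx h) (fun y => nabla i y (u p) (v p)) (x p)
    + nabla i (x p) (du h) (v p) + nabla i (x p) (u p) (dv h)).
Proof.
apply: (@is_diff_bilinear_pullback R V _ _ n n (cimg i) (nabla i) x dx u du v dv p) => //.
- by move=> y Cy b a w w'; exact: (conn_linearl cn Cy).
- by move=> y Cy b a w w'; exact: (conn_linearr cn Cy).
- by move=> a b; exact: smooth_on_differentiable (conn_smooth cn i a b) Cx.
Qed.

End Differentials.

End LocalGeometry.

Section Curves.
Context {R : realType}.
Implicit Types W : normedModType R.

Lemma is_diff_derive1 W (F dF : R -> W) t : is_diff t F dF -> derive1 F t = dF 1.
Proof. by move=> Ft; rewrite derive1E (is_diff_derive (1 : R) Ft). Qed.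

Lemma near_eq_derive1 W (F G : R -> W) t :
  (\forall s \near t, F s = G s) -> derive1 F t = derive1 G t.
Proof. by move=> FG; rewrite !derive1E; exact: near_eq_derive. Qed.

Lemma derive_linear_direction W n (f : 'rV[R]_n -> W) q a (u v : 'rV[R]_n) :
  differentiable f q -> 'D_(a *: u + v) f q = a *: 'D_u f q + 'D_v f q.
Proof. by move=> fq; rewrite !deriveE // linearP. Qed.

Lemma derive1_lsubmx n1 n2 (z : R -> 'rV[R]_(n1 + n2)) t : differentiable z t ->
  derive1 (fun s => lsubmx (z s)) t = lsubmx (derive1 z t).
Proof.
move=> /is_diff_derivable1 zt.
have H := is_diff_linear (@continuous_lsubmx R 1 n1 n2) zt.
by rewrite (is_diff_derive1 H) /= scale1r.
Qed.

Lemma derive1_rsubmx n1 n2 (z : R -> 'rV[R]_(n1 + n2)) t : differentiable z t ->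
  derive1 (fun s => rsubmx (z s)) t = rsubmx (derive1 z t).
Proof.
move=> /is_diff_derivable1 zt.
have H := is_diff_linear (@continuous_rsubmx R 1 n1 n2) zt.
by rewrite (is_diff_derive1 H) /= scale1r.
Qed.

End Curves.

(** * The induced metric along a horizontal lift *)

Section PulledBackMetric.
Context {R : realType} {m : nat} {M : atlas R m.*2}.
Context {g : form_field M} {nabla : conn_field M} {phi : endo_field M}.
Hypothesis pkn : para_kahler_norden g nabla phi.
Variable i : chart M.
Notation n := m.*2.

Let gR := pkn_metric pkn.
Let lc := pkn_levi_civita pkn.
Let cn := lc_connection lc.

Variables (d : nat) (f : 'rV[R]_d -> 'rV[R]_(n + n)) (U : set 'rV[R]_d).
Hypotheses (oU : open U) (fU : smooth_on U f).
Hypothesis fC : forall y, U y -> cimg i (lsubmx (f y)).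

Definition push_h (a y : 'rV[R]_d) : 'rV[R]_n := lsubmx ('D_a f y).
Definition push_v (a y : 'rV[R]_d) : 'rV[R]_n := vpart nabla i (f y) ('D_a f y).
Definition pulled_metric (y a b : 'rV[R]_d) : R :=
  phi_sasaki nabla g phi i (f y) ('D_a f y) ('D_b f y).
(** [cov_h] and [cov_v] are the covariant derivatives, along the base map [lsubmx o f], of the
    horizontal and vertical components of a coordinate vector field. Exchanging the two directions
    preserves [cov_h], but changes [cov_v] by a curvature term. *)
Definition cov_h (y c a : 'rV[R]_d) : 'rV[R]_n :=
  lsubmx ('D_c ('D_a f) y) + nabla i (lsubmx (f y)) (push_h c y) (push_h a y).
Definition cov_v (y c a : 'rV[R]_d) : 'rV[R]_n :=
  'D_c (push_v a) y + nabla i (lsubmx (f y)) (push_h c y) (push_v a y).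

Lemma is_diff_lf y : U y ->
  is_diff y (fun q => lsubmx (f q)) (fun h => lsubmx ('D_h f y)).
Proof.
move=> Uy; have fy := smooth_on_differentiable fU Uy.
have H := is_diff_linear (@continuous_lsubmx R 1 n n) (differentiableP fy).
by apply: is_diff_ext H => h //=; rewrite deriveE.
Qed.

Lemma is_diff_push_h a y : U y ->
  is_diff y (push_h a) (fun h => lsubmx ('D_h ('D_a f) y)).
Proof.
move=> Uy; have fy := smooth_on_differentiable (smooth_on_derive a fU) Uy.
have H := is_diff_linear (@continuous_lsubmx R 1 n n) (differentiableP fy).
by apply: is_diff_ext H => h //=; rewrite deriveE.
Qed.

Lemma is_diff_push_v a y : U y -> is_diff y (push_v a) (fun h => 'D_h (push_v a) y).
Proof.
move=> Uy; apply: (is_diffP _ (fun h => erefl)).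
have fy := differentiableP (smooth_on_differentiable fU Uy).
have dfy := differentiableP (smooth_on_differentiable (smooth_on_derive a fU) Uy).
have H1 := is_diff_linear (@continuous_rsubmx R 1 n n) dfy.
have H2 := is_diff_conn (x := fun q => lsubmx (f q)) pkn (fC Uy) (is_diff_lf Uy) (is_diff_push_h a Uy)
  (is_diff_linear (@continuous_rsubmx R 1 n n) fy).
exact: (@ex_diff _ _ _ _ _ _ _ (is_diffD H1 H2)).
Qed.

Lemma cov_h_sym y c a : U y -> cov_h y c a = cov_h y a c.
Proof.
move=> Uy; exact: (f_equal2 (fun A B => lsubmx A + B)
  (smooth_derive_sym a c oU Uy fU) (lc_torsion_free lc (fC Uy) _ _)).
Qed.

Lemma vertical_form_sym x : cimg i x -> forall u v,
  g i x u (v *m phi i x) = g i x v (u *m phi i x).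
Proof. by move=> Cx u v; rewrite -(pkn_compatible pkn Cx) (Defs.metric_sym gR Cx). Qed.

Lemma pulled_metric_sym y a b : U y -> pulled_metric y a b = pulled_metric y b a.
Proof.
move=> Uy; exact: (f_equal2 +%R (Defs.metric_sym gR (fC Uy) _ _)
  (vertical_form_sym (fC Uy) _ _)).
Qed.

(** Both g and g(., phi .) are parallel for [nabla], so only the components are differentiated,
    covariantly. *)
Lemma derive_pulled_metric y a b c : U y ->
  'D_c (fun q => pulled_metric q a b) y =
  g i (lsubmx (f y)) (cov_h y c a) (push_h b y)
  + g i (lsubmx (f y)) (push_h a y) (cov_h y c b)
  + (g i (lsubmx (f y)) (cov_v y c a) (push_v b y *m phi i (lsubmx (f y)))
     + g i (lsubmx (f y)) (push_v a y) (cov_v y c b *m phi i (lsubmx (f y)))).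
Proof.
move=> Uy; have Cy := fC Uy.
have Hh := is_diff_metric (x := fun q => lsubmx (f q)) pkn Cy (is_diff_lf Uy) (is_diff_push_h a Uy) (is_diff_push_h b Uy).
have Hv := is_diff_metric (x := fun q => lsubmx (f q)) pkn Cy (is_diff_lf Uy) (is_diff_push_v a Uy)
  (is_diff_endo (x := fun q => lsubmx (f q)) pkn Cy (is_diff_lf Uy) (is_diff_push_v b Uy)).
have H := is_diffD Hh Hv.
have -> : (fun q => pulled_metric q a b) =
  (fun q => g i (lsubmx (f q)) (push_h a q) (push_h b q)) +
  (fun q => g i (lsubmx (f q)) (push_v a q) (push_v b q *m phi i (lsubmx (f q)))) by [].
by rewrite (is_diff_derive c H) [LHS]/= -[LHS]/(_ + _) subrK.
Qed.

(* Koszul's formula; on a horizontal vector every curvature term is multiplied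
   by the vertical part, which vanishes. *)
Lemma koszul_horizontal y (Gamma : 'rV[R]_d -> 'rV[R]_d -> 'rV[R]_d) a b : U y ->
  (forall u v, Gamma u v = Gamma v u) ->
  (forall u v w, 'D_w (fun q => pulled_metric q u v) y =
     pulled_metric y (Gamma w u) v + pulled_metric y u (Gamma w v)) ->
  push_v a y = 0 ->
  pulled_metric y (Gamma a a) b =
    g i (lsubmx (f y)) (cov_h y a a) (push_h b y)
    + g i (lsubmx (f y)) ('D_a (push_v a) y) (push_v b y *m phi i (lsubmx (f y))).
Proof.
move=> Uy Gs GG a0; have Cy := fC Uy.
(* Half of [E2] (derivative of <a,a> along b) subtracted from [E1] (derivative of <a,b> along a)
   isolates [Gamma a a]. The asymmetric terms [cov_v y a b] and [cov_v y b a] are paired only with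
   [push_v a y], which is 0. *)
have E1 := etrans (esym (derive_pulled_metric a b a Uy)) (GG a b a).
have E2 := etrans (esym (derive_pulled_metric a a b Uy)) (GG a a b).
move: E1 E2; rewrite (Gs b a) (pulled_metric_sym (Gamma a b) a Uy).
rewrite (cov_h_sym b a Uy) [cov_v y a a]/cov_v a0.
move: (cov_h y a a) (cov_h y a b) (push_h a y) (push_h b y) (push_v b y)
  ('D_a (push_v a) y) (cov_v y a b) (cov_v y b a) => caa cab pa pb vb dva vab vba.
rewrite (conn0r pkn _ Cy) addr0 mul0mx !(metric0l pkn _ Cy) !(metric0r pkn _ Cy).
rewrite (Defs.metric_sym gR Cy cab).
move: (g i (lsubmx (f y))) (pulled_metric y) => G P E1 E2; lra.
Qed.

Variables (w : R -> 'rV[R]_d) (t : R).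
Hypothesis wU : \forall s \near t, U (w s) /\ differentiable w s.
Hypothesis w't : differentiable (derive1 w) t.
Let z s := f (w s).
Hypothesis zh : \forall s \near t, vpart nabla i (z s) (derive1 z s) = 0.

Let Ut : U (w t). Proof. by have [] := nbhs_singleton wU. Qed.

Let wt : is_diff t w (fun h => h *: derive1 w t).
Proof. by apply: is_diff_derivable1; have [] := nbhs_singleton wU. Qed.

Let w''t := is_diff_derivable1 w't.

Let z'E : \forall s \near t, derive1 z s = 'D_(derive1 w s) f (w s) /\ differentiable z s.
Proof.
apply: filterS wU => s [Us ws].
have fs := smooth_on_differentiable fU Us.
have H := is_diff_comp (is_diff_derivable1 ws) (differentiableP fs).
split; last exact: (@ex_diff _ _ _ _ _ _ _ H).
by apply: etrans (is_diff_derive1 H) _; rewrite /= scale1r deriveE.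
Qed.

Let z't : is_diff t (fun s => 'D_(derive1 w s) f (w s))
  (fun h => 'd ('D_(derive1 w t) f) (w t) (h *: derive1 w t)
            + 'D_(h *: derive1 (derive1 w) t) f (w t)).
Proof.
apply: (@is_diff_linear_family R _ _ d (fun s a => 'D_a f (w s))
  (fun h a => 'd ('D_a f) (w t) (h *: derive1 w t)) _ _ t _ _ w''t).
- apply: filterS wU => s [Us _] a u v.
  by apply: derive_linear_direction; exact: smooth_on_differentiable fU Us.
- move=> a; apply: (is_diff_comp wt (differentiableP _)).
  exact: smooth_on_differentiable (smooth_on_derive _ fU) Ut.
Qed.

Let z'near : \forall s \near t, 'D_(derive1 w s) f (w s) = derive1 z s.
Proof. by apply: filterS z'E => s [zs _]; exact: esym zs. Qed.

Lemma second_derivative_lift : derive1 (derive1 z) t =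
  'D_(derive1 w t) ('D_(derive1 w t) f) (w t) + 'D_(derive1 (derive1 w) t) f (w t).
Proof.
have E := is_diff_derive1 z't; apply: etrans (etrans (esym _) E) _.
  exact: near_eq_derive1 z'near.
have dfU : differentiable ('D_(derive1 w t) f) (w t).
  exact: smooth_on_differentiable (smooth_on_derive _ fU) Ut.
cbv beta; rewrite !scale1r; exact: f_equal2 (esym (deriveE _ dfU)) erefl.
Qed.

Lemma push_v_horizontal : push_v (derive1 w t) (w t) = 0.
Proof.
have := nbhs_singleton zh; rewrite /push_v /z.
by have [-> _] := nbhs_singleton z'E.
Qed.

(** The vertical part of the velocity vanishes at all times near [t], so its derivative does too;
    the chain rule splits it into these two terms. This eliminates the vertical contribution of
    [w'']. *)
Lemma derive_push_v_horizontal :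
  'D_(derive1 w t) (push_v (derive1 w t)) (w t) + push_v (derive1 (derive1 w) t) (w t) = 0.
Proof.
have E0 : derive1 (fun s => push_v (derive1 w s) (w s)) t = 0.
  apply: (etrans (near_eq_derive1 (G := cst 0) _)); last exact: derive1_cst.
  by apply: filterS2 z'E zh => s [zs _] zv; rewrite /push_v -zs; exact: zv.
have H : is_diff t (fun s => push_v (derive1 w s) (w s))
    (fun h => 'D_(h *: derive1 w t) (push_v (derive1 w t)) (w t)
              + push_v (h *: derive1 (derive1 w) t) (w t)).
  apply: (@is_diff_linear_family R _ _ d (fun s a => push_v a (w s))
    (fun h a => 'D_(h *: derive1 w t) (push_v a) (w t)) _ _ t _ _ w''t).
  - apply: filterS wU => s [Us _] a u v.
    rewrite /push_v derive_linear_direction ?(vpart_linear pkn) //; first exact: fC.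
    exact: smooth_on_differentiable fU Us.
  - by move=> a; exact: (is_diff_comp wt (is_diff_push_v a Ut)).
have := is_diff_derive1 H; cbv beta; rewrite !scale1r => E1.
exact: etrans (esym E1) E0.
Qed.

(** The contribution of [w''] disappears from both components: horizontally it is absorbed by the
    second derivative of [x], vertically it is replaced through [derive_push_v_horizontal]. What
    remains is the identity [koszul_horizontal]. *)
Lemma acceleration_orthogonal (Gamma : 'rV[R]_d -> 'rV[R]_d -> 'rV[R]_d) b :
  (forall u v, Gamma u v = Gamma v u) ->
  (forall u v c, 'D_c (fun q => pulled_metric q u v) (w t) =
     pulled_metric (w t) (Gamma c u) v + pulled_metric (w t) u (Gamma c v)) ->
  let x s := lsubmx (z s) in
  let acc := derive1 (derive1 w) t + Gamma (derive1 w t) (derive1 w t) in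
  let accx := derive1 (derive1 x) t + nabla i (x t) (derive1 x t) (derive1 x t) in
  phi_sasaki nabla g phi i (z t) ('D_acc f (w t) - hlift nabla i (z t) accx)
    ('D_b f (w t)) = 0.
Proof.
move=> Gs GG x acc accx; have Ct := fC Ut.
have ft := smooth_on_differentiable fU Ut.
have x'E : \forall s \near t, derive1 x s = lsubmx (derive1 z s).
  by apply: filterS z'E => s [_ zs]; exact: derive1_lsubmx.
have x't : derive1 x t = push_h (derive1 w t) (w t).
  by rewrite (nbhs_singleton x'E) (nbhs_singleton z'E).1.
have z'd : differentiable (derive1 z) t.
  exact: near_eq_differentiable z'near (@ex_diff _ _ _ _ _ _ _ z't).
have x''t : derive1 (derive1 x) t = lsubmx (derive1 (derive1 z) t).
  by rewrite (near_eq_derive1 x'E) derive1_lsubmx.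
have Cz : cimg i (lsubmx (z t)) := Ct.
pose w1 := derive1 w t; pose w2 := derive1 (derive1 w) t; pose G1 := Gamma w1 w1.
have accE : 'D_acc f (w t) = 'D_w2 f (w t) + 'D_G1 f (w t).
  by have E := derive_linear_direction 1 w2 G1 ft; rewrite !scale1r in E.
have K := koszul_horizontal b Ut Gs GG push_v_horizontal.
have vE : vpart nabla i (z t) ('D_acc f (w t) - hlift nabla i (z t) accx) =
    push_v G1 (w t) - 'D_w1 (push_v w1) (w t).
  have E1 : push_v w2 (w t) = - 'D_w1 (push_v w1) (w t).
    by apply/eqP; rewrite -addr_eq0 addrC; apply/eqP; exact: derive_push_v_horizontal.
  have VB := vpartB pkn ('D_acc f (w t)) (hlift nabla i (z t) accx) Cz.
  have VD := vpartD pkn ('D_w2 f (w t)) ('D_G1 f (w t)) Cz.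
  have VA := etrans (f_equal (vpart nabla i (z t)) accE) VD.
  have VH := vpart_hlift nabla i (z t) accx.
  apply: (etrans VB); apply: (etrans (f_equal2 (fun A B => A - B) VA VH)).
  exact: etrans (subr0 _) (etrans (addrC _ _) (f_equal2 +%R erefl E1)).
have hE : hpart ('D_acc f (w t) - hlift nabla i (z t) accx) =
    push_h G1 (w t) - cov_h (w t) w1 w1.
  have E1 : lsubmx ('D_acc f (w t)) = push_h w2 (w t) + push_h G1 (w t).
    by rewrite accE linearD.
  have E2 : accx = (lsubmx ('D_w1 ('D_w1 f) (w t)) + push_h w2 (w t))
      + nabla i (x t) (push_h w1 (w t)) (push_h w1 (w t)).
    by rewrite /accx x''t second_derivative_lift linearD x't.
  have LB : lsubmx ('D_acc f (w t) - hlift nabla i (z t) accx) =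
      lsubmx ('D_acc f (w t)) - lsubmx (hlift nabla i (z t) accx) by exact: linearB.
  apply: etrans LB _; rewrite E1 [lsubmx (hlift _ _ _ _)]row_mxKl E2 /cov_h.
  move: (lsubmx ('D_w1 _ _)) (push_h w2 _) (push_h G1 _) (nabla i _ _ _) => A B C D.
  by rewrite [A + B]addrC -[B + A + D]addrA opprD addrA [B + C]addrC addrK.
have alg (p q r s : R) : p + r = q + s -> (p - q) + (r - s) = 0.
  by move=> E; rewrite addrACA E -opprD subrr.
have Eh := etrans (f_equal2 (g i (lsubmx (z t))) hE (erefl (hpart ('D_b f (w t)))))
  (metricBl pkn _ _ _ Cz).
have Ev := etrans (f_equal2 (g i (lsubmx (z t))) vE
  (erefl (vpart nabla i (z t) ('D_b f (w t)) *m phi i (lsubmx (z t)))))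
  (metricBl pkn _ _ _ Cz).
exact: etrans (f_equal2 +%R Eh Ev) (alg _ _ _ _ K).
Qed.

End PulledBackMetric.

(** Dimension count: the rank of [J] is [p.-1], and adjoining [v] strictly increases it. Here [J]
    will span the tangent space of the hypersurface and [v] be the vertical lift of xi. *)
Lemma row_free_add_line (F : fieldType) (p : nat) (J : 'M[F]_(p.-1, p)) (v a : 'rV[F]_p) :
  row_free J -> ~~ (v <= J)%MS -> exists u c, a = u *m J + c *: v.
Proof.
move=> Jf vJ.
have Jlt : (J < J + v)%MS.
  by rewrite ltmxE addsmxSl /= addsmx_sub negb_and vJ orbT.
have full : row_full (J + v)%MS.
  rewrite /row_full eqn_leq rank_leq_col /=.
  have := rank_ltmx Jlt; rewrite (eqP Jf); exact: leq_trans (leqSpred p).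
have /sub_addsmxP[[u c] /= ->] : (a <= J + v)%MS by exact: submx_full.
by exists u, (c 0 0); rewrite {1}[c]mx11_scalar mul_scalar_mx.
Qed.

(** * Normal direction of the unit bundle, and horizontal lifts as curves of TM *)

Section UnitBundle.
Context {R : realType} {m : nat} {M : atlas R m.*2}.
Context {g : form_field M} {nabla : conn_field M} {phi : endo_field M}.
Hypothesis pkn : para_kahler_norden g nabla phi.
Notation n := m.*2.

Let gR := pkn_metric pkn.
Let lc := pkn_levi_civita pkn.
Let cn := lc_connection lc.

Lemma phi_sasaki_linearr (i : chart M) z a k b c : cimg i (lsubmx z) ->
  phi_sasaki nabla g phi i z a (k *: b + c) =
  k * phi_sasaki nabla g phi i z a b + phi_sasaki nabla g phi i z a c.
Proof.
move=> Cz.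
have hE : hpart (k *: b + c) = k *: hpart b + hpart c by exact: linearP.
rewrite /phi_sasaki hE (vpart_linear pkn _ _ _ Cz) mulmxDl -scalemxAl.
by rewrite !(metric_linearr pkn Cz) mulrDr addrACA.
Qed.

Lemma phi_sasaki_sym (i : chart M) z a b : cimg i (lsubmx z) ->
  phi_sasaki nabla g phi i z a b = phi_sasaki nabla g phi i z b a.
Proof.
move=> Cz; exact: (f_equal2 +%R (Defs.metric_sym gR Cz _ _)
  (vertical_form_sym pkn Cz _ _)).
Qed.

(** The metric is indefinite on vertical vectors, but pairing with the vertical lift of phi applied
    to the vertical part gives, as phi is an involution, the positive definite square for g. *)
Lemma phi_sasaki_nondegenerate (i : chart M) z a : cimg i (lsubmx z) ->
  (forall b, phi_sasaki nabla g phi i z a b = 0) -> a = 0.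
Proof.
move=> Cz a0.
have hz : hpart a = 0.
  apply/eqP/negPn/negP => /(metric_pos gR Cz); apply/negP; rewrite -leNgt.
  have := a0 (hlift nabla i z (hpart a)); rewrite /phi_sasaki hpart_hlift vpart_hlift.
  by rewrite mul0mx (metric0r pkn _ Cz) addr0 => ->.
have vz : vpart nabla i z a = 0.
  apply/eqP/negPn/negP => /(metric_pos gR Cz); apply/negP; rewrite -leNgt.
  have := a0 (vlift (vpart nabla i z a *m phi i (lsubmx z))).
  rewrite /phi_sasaki hpart_vlift (vpart_vlift _ cn Cz) -mulmxA (pkn_involution pkn Cz).
  by rewrite mulmx1 (metric0r pkn _ Cz) add0r => ->.
rewrite (hv_decomposition nabla i z a) hz vz /hlift /vlift (conn0l pkn _ Cz) oppr0.
by rewrite !row_mx0 addr0.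
Qed.

Section LocalParam.
Variable s : local_param (phi_unit_set g phi) (n + n).-1.
Let j : chart M := lp_chart s.
Let f := lp_map s.
Let So : open (lp_dom s) := @lp_open _ _ _ _ _ s.

(** The embedding property, applied to the whole domain, places the image in the hypersurface. *)
Lemma lp_image y : lp_dom s y -> exists q : mpoint (tangent_bundle M),
  [/\ phi_unit_set g phi q, cdom (a := tangent_bundle M) j q &
      f y = chart_map (a := tangent_bundle M) j q].
Proof.
move=> Uy; have [B oB E] := lp_embedding So (@subset_refl _ (lp_dom s)).
have : (lp_map s @` lp_dom s) (lp_map s y) by exists y.
by rewrite E => -[_ [q [Sq jq] qE]]; exists q; rewrite /f -qE.
Qed.

Lemma lp_cimg y : lp_dom s y -> cimg j (lsubmx (f y)).
Proof.
move=> /lp_image[q [_ [_ _ jq] ->]]; rewrite row_mxKl; by exists q.1.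
Qed.

Lemma lp_unit y : lp_dom s y ->
  g j (lsubmx (f y)) (rsubmx (f y)) (rsubmx (f y) *m phi j (lsubmx (f y))) = 1.
Proof.
by move=> /lp_image[q [[_ q1] [_ _ jq] ->]]; rewrite row_mxKl row_mxKr; exact: q1.
Qed.

Let fU : smooth_on (lp_dom s) f := lp_smooth s.

(* The vertical lift of xi is half the gradient, for the phi-Sasaki metric, of
   g(xi, phi xi), which is constant along [f]. *)
Lemma normal_orthogonal y a : lp_dom s y ->
  phi_sasaki nabla g phi j (f y) ('D_a f y) (vlift (rsubmx (f y))) = 0.
Proof.
move=> Uy; have Cy := lp_cimg Uy.
have lf := is_diff_lf fU Uy.
have fy := smooth_on_differentiable fU Uy.
have rf : is_diff y (fun q => rsubmx (f q)) (fun h => rsubmx ('D_h f y)).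
  have H := is_diff_linear (@continuous_rsubmx R 1 n n) (differentiableP fy).
  by apply: is_diff_ext H => h //=; rewrite deriveE.
have H := is_diff_metric (x := fun q => lsubmx (f q)) pkn Cy lf rf
  (is_diff_endo (x := fun q => lsubmx (f q)) pkn Cy lf rf).
have E1 := is_diff_derive a H.
have E0 : 'D_a (fun q => g j (lsubmx (f q)) (rsubmx (f q))
    (rsubmx (f q) *m phi j (lsubmx (f q)))) y = 0.
  apply: etrans (_ : _ = 'D_a (cst (1 : R)) y) (derive_cst (1 : R) y a).
  apply: near_eq_derive.
  by apply: filterS (open_near So Uy) => q Uq; exact: lp_unit.
have := etrans (esym E1) E0; cbv beta.
rewrite subrK -/(vpart nabla j (f y) ('D_a f y)).
rewrite /phi_sasaki hpart_vlift (vpart_vlift _ cn Cy) (metric0r pkn _ Cy) add0r.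
rewrite -/(vpart nabla j (f y) ('D_a f y)).
move: (vpart _ _ _ _) => v.
rewrite [g j _ (rsubmx _) (v *m _)](vertical_form_sym pkn Cy).
by move=> /eqP; rewrite -mulr2n mulrn_eq0 /= => /eqP.
Qed.

Lemma tangent_normal_span y a : lp_dom s y ->
  (forall b, phi_sasaki nabla g phi j (f y) a ('D_b f y) = 0) ->
  phi_sasaki nabla g phi j (f y) a (vlift (rsubmx (f y))) = 0 -> a = 0.
Proof.
move=> Uy at0 an0; have Cy := lp_cimg Uy.
have fy := smooth_on_differentiable fU Uy.
(* A tangent vertical lift of xi would be orthogonal to itself, whereas its square is g(xi, phi xi)
   = 1. *)
have nJ : ~~ (vlift (rsubmx (f y)) <= 'J f y)%MS.
  apply/negP => /submxP[u uE].
  have := normal_orthogonal u Uy; rewrite (deriveEjacobian u fy) -uE.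
  rewrite (phi_sasaki_vv phi cn gR Cy) lp_unit // => /eqP; by rewrite oner_eq0.
apply: (phi_sasaki_nondegenerate Cy) => b.
have [u [c ->]] := row_free_add_line b (lp_immersion Uy) nJ.
rewrite addrC (phi_sasaki_linearr _ _ _ _ Cy) an0 mulr0 add0r.
by rewrite -(deriveEjacobian u fy); exact: at0.
Qed.

End LocalParam.

Section Lift.
Variables (I : set R) (gamma : R -> mpoint M) (xi : R -> chart M -> 'rV[R]_n).
Let Gamma : R -> mpoint (tangent_bundle M) := fun t => (gamma t, xi t).
Hypotheses (Is : smooth_curve I Gamma) (hor : horizontal_along nabla I gamma xi).

Let z (j : chart M) (r : R) : 'rV[R]_(n + n) := chart_map (a := tangent_bundle M) j (Gamma r).
Let T (j : chart M) : set R := I `&` Gamma @^-1` (cdom (a := tangent_bundle M) j).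

Lemma lift_open j : open (T j).
Proof. exact: (@curve_open _ _ _ _ _ Is j). Qed.

Lemma lift_smooth j : smooth_on (T j) (z j).
Proof. exact: (curve_smooth Is j). Qed.

Lemma lift_derive1 j t : T j t -> differentiable (z j) t /\ differentiable (derive1 (z j)) t.
Proof.
move=> Tt; split; first exact: smooth_on_differentiable (lift_smooth j) Tt.
have -> : derive1 (z j) = 'D_(1 : R) (z j) by apply/funext => r; exact: derive1E.
exact: smooth_on_differentiable (smooth_on_derive (1 : R) (lift_smooth j)) Tt.
Qed.

(** The vertical part of the velocity of a curve (gamma, xi) is the covariant derivative of xi along
    gamma. *)
Lemma lift_vpart j t : T j t -> vpart nabla j (z j t) (derive1 (z j) t) = 0.
Proof.
move=> Tt; have [zt _] := lift_derive1 Tt; have [It [_ _ jt]] := Tt.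
have := hor It jt; rewrite /cov_deriv /velocity.
have -> : (fun r => chart_map j (gamma r)) = (fun r => lsubmx (z j r)).
  by apply/funext => r; rewrite row_mxKl.
have -> : (fun r => xi r j) = (fun r => rsubmx (z j r)).
  by apply/funext => r; rewrite row_mxKr.
rewrite derive1_lsubmx // derive1_rsubmx // => <-.
by rewrite /vpart row_mxKl row_mxKr.
Qed.

Lemma lift_velocity j t : T j t ->
  velocity (M := tangent_bundle M) Gamma t j = hlift nabla j (z j t) (velocity gamma t j).
Proof.
move=> Tt; have [zt _] := lift_derive1 Tt.
rewrite /velocity -[LHS]/(derive1 (z j) t).
have -> : (fun r => chart_map j (gamma r)) = (fun r => lsubmx (z j r)).
  by apply/funext => r; rewrite row_mxKl.
rewrite derive1_lsubmx // [LHS](hv_decomposition nabla j (z j t)) lift_vpart //.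
by rewrite /vlift row_mx0 addr0.
Qed.

End Lift.

End UnitBundle.

(** * The acceleration of a horizontal lift *)

Section LiftAcceleration.
Context {R : realType} {m : nat} {M : atlas R m.*2}.
Context {g : form_field M} {nabla : conn_field M} {phi : endo_field M}.
Context {nabla_hat : conn_field (phi_unit_bundle g phi)}.
Hypothesis pkn : para_kahler_norden g nabla phi.
Hypothesis lch : levi_civita (phi_unit_metric g phi nabla) nabla_hat.
Notation n := m.*2.

Variables (I : set R) (gamma : R -> mpoint M) (xi : R -> chart M -> 'rV[R]_n).
Let Gamma : R -> mpoint (tangent_bundle M) := fun t => (gamma t, xi t).
Hypotheses (Is : smooth_curve I Gamma) (hor : horizontal_along nabla I gamma xi).
Hypothesis Iunit : forall t, I t -> phi_unit_set g phi (Gamma t).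

Variable s : local_param (phi_unit_set g phi) (n + n).-1.
Let j : chart M := lp_chart s.
Let f := lp_map s.
Let z (r : R) : 'rV[R]_(n + n) := chart_map (a := tangent_bundle M) j (Gamma r).
Let w (r : R) : 'rV[R]_(n + n).-1 := lp_inv s (z r).
Let T : set R := I `&` Gamma @^-1` (cdom (a := tangent_bundle M) j).
Let Ts : set R := T `&` [set r | (f @` lp_dom s) (z r)].

Let To : open T := lift_open (j := j) Is.
Let So : open (lp_dom s) := @lp_open _ _ _ _ _ s.
Let fU : smooth_on (lp_dom s) f := lp_smooth s.

Let zc r : T r -> {for r, continuous z}.
Proof. exact: smooth_on_continuous (lift_smooth Is j). Qed.

(** Images of open sets are relatively open in the hypersurface, and Gamma does not leave it. With
    the whole domain as [W] this makes the chart usable near [r]; with small [W] it gives the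
    continuity of [w]. *)
Let near_image (W : set 'rV[R]_(n + n).-1) r : open W -> W `<=` lp_dom s ->
  T r -> (f @` W) (z r) -> \forall q \near r, T q /\ (f @` W) (z q).
Proof.
move=> oW WU Tr zr; have [B oB E] := lp_embedding oW WU.
have zB : \forall q \near r, B (z q).
  by apply: (zc Tr); apply: open_near oB _; move: zr; rewrite E => -[].
apply: filterS2 (open_near To Tr) zB => q Tq Bq; split=> //.
rewrite E; split=> //; exists (Gamma q) => //; split; last by have [] := Tq.
by apply: Iunit; have [] := Tq.
Qed.

Let lift_param r : Ts r -> lp_dom s (w r) /\ f (w r) = z r.
Proof. by move=> [_ [y Uy yz]]; rewrite /w -yz lp_mapK. Qed.

Let Ts_near r : Ts r -> \forall q \near r, Ts q.
Proof. by move=> [Tr zr]; exact: near_image So (@subset_refl _ _) Tr zr. Qed.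

Let w_continuous r : Ts r -> {for r, continuous w}.
Proof.
move=> Tsr B; rewrite nbhsE => -[B0 [oB0 B0w] B0B].
have [Uw fw] := lift_param Tsr; have [Tr _] := Tsr.
have zr : (f @` (B0 `&` lp_dom s)) (z r) by exists (w r).
have := near_image (openI oB0 So) (@subIsetr _ _ _) Tr zr.
by apply: filterS => q [_ [y [B0y Uy] yz]]; apply: B0B; rewrite /w -yz lp_mapK.
Qed.

Let fw_near r : Ts r -> \forall q \near r, f (w q) = z q.
Proof. by move=> Tsr; apply: filterS (Ts_near Tsr) => q /lift_param[]. Qed.

Let w_differentiable r : Ts r -> differentiable w r.
Proof.
move=> Tsr; have [Uw _] := lift_param Tsr; have [Tr _] := Tsr.
apply: differentiable_immersion_lift (fw_near Tsr) _ => //.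
- exact: smooth_on_differentiable fU Uw.
- exact: lp_immersion Uw.
- exact: w_continuous.
- by have [] := lift_derive1 Is Tr.
Qed.

Let w'E r : Ts r -> 'D_(derive1 w r) f (w r) = derive1 z r.
Proof.
move=> Tsr; have [Uw _] := lift_param Tsr.
have fd := smooth_on_differentiable fU Uw.
have H := is_diff_comp (is_diff_derivable1 (w_differentiable Tsr)) (differentiableP fd).
have E : derive1 (f \o w) r = 'D_(derive1 w r) f (w r).
  by apply: etrans (is_diff_derive1 H) _; rewrite /= scale1r deriveE.
by rewrite -E; apply: near_eq_derive1; exact: fw_near.
Qed.

(** Differentiating [f o w = z] gives a linear system for [w'] with coefficients ['D_u f (w q)], for
    which a right inverse of the Jacobian at [w r] suffices. *)
Let w'_differentiable r : Ts r -> differentiable (derive1 w) r.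
Proof.
move=> Tsr; have [Uw _] := lift_param Tsr; have [Tr _] := Tsr.
have /row_freeP[B JB] := lp_immersion Uw.
apply: (@differentiable_linear_lift R _ _ (fun q u => 'D_u f (w q)) B _ (derive1 z)).
- apply: filterS (Ts_near Tsr) => q /lift_param[Uq _] a u v.
  by apply: derive_linear_direction; exact: smooth_on_differentiable fU Uq.
- move=> u; have dfd := smooth_on_differentiable (smooth_on_derive u fU) Uw.
  exact: (@differentiable_comp _ _ _ _ w ('D_u f) r (w_differentiable Tsr) dfd).
- move=> u; have fd := smooth_on_differentiable fU Uw.
  by rewrite (deriveEjacobian u fd) -mulmxA JB mulmx1.
- by apply: filterS (Ts_near Tsr) => q; exact: w'E.
- by have [] := lift_derive1 Is Tr.
Qed.

Lemma acceleration_lift t : I t -> cdom (a := phi_unit_bundle g phi) s (Gamma t) ->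
  inclusion_push s (chart_map (a := phi_unit_bundle g phi) s (Gamma t))
    (acceleration nabla_hat Gamma t s) =
  hlift nabla j (z t) (acceleration nabla gamma t j).
Proof.
move=> It st; have [_ jt zt] := st.
have Tst : Ts t by split.
have [Uw fw] := lift_param Tst; have [Tt _] := Tst.
have fd := smooth_on_differentiable fU Uw.
have cs : cimg (M := phi_unit_bundle g phi) s (w t) by exists (Gamma t).
pose G := nabla_hat s (w t).
pose acc := derive1 (derive1 w) t + G (derive1 w t) (derive1 w t).
pose x r : 'rV[R]_n := lsubmx (f (w r)).
have wU : \forall q \near t, lp_dom s (w q) /\ differentiable w q.
  apply: filterS (Ts_near Tst) => q Tsq.
  by split; [have [] := lift_param Tsq|exact: w_differentiable].
have zE : \forall q \near t, derive1 (fun r => f (w r)) q = derive1 z q.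
  by apply: filterS (Ts_near Tst) => q Tsq; apply: near_eq_derive1; exact: fw_near.
have zh : \forall q \near t, vpart nabla j (f (w q)) (derive1 (fun r => f (w r)) q) = 0.
  have zv : \forall q \near t, vpart nabla j (z q) (derive1 z q) = 0.
    by apply: filterS (open_near To Tt) => q; exact: (lift_vpart Is hor).
  by apply: filterS3 zE (fw_near Tst) zv => q -> -> .
have GG u v c : 'D_c (fun q => pulled_metric (g := g) (nabla := nabla) (phi := phi) j f q u v) (w t) =
    pulled_metric (g := g) (nabla := nabla) (phi := phi) j f (w t) (G c u) v
    + pulled_metric (g := g) (nabla := nabla) (phi := phi) j f (w t) u (G c v).
  (* The induced metric is written with Jacobians, [pulled_metric] with directional derivatives;
     they are compared on the open domain only, which is enough for derivatives. *)
  have ind q a b : lp_dom s q -> phi_unit_metric g phi nabla s q a b =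
      pulled_metric (g := g) (nabla := nabla) (phi := phi) j f q a b.
    move=> Uq; have fq := smooth_on_differentiable fU Uq.
    by rewrite /pulled_metric (deriveEjacobian a fq) (deriveEjacobian b fq).
  rewrite -!ind //; apply: etrans (lc_metric lch cs u v c); apply: near_eq_derive.
  by apply: filterS (open_near So Uw) => q Uq; rewrite ind.
have Gs u v : G u v = G v u by exact: (lc_torsion_free lch cs).
have orth b := acceleration_orthogonal pkn So fU (@lp_cimg _ _ _ _ _ s) wU
  (w'_differentiable Tst) zh b Gs GG.
have xE : \forall q \near t, x q = chart_map j (gamma q).
  by apply: filterS (fw_near Tst) => q fwq; rewrite /x fwq row_mxKl.
have x'E : \forall q \near t, derive1 x q = velocity gamma q j.
  apply: filterS (Ts_near Tst) => q Tsq; apply: near_eq_derive1.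
  by apply: filterS (fw_near Tsq) => r fwr; rewrite /x fwr row_mxKl.
have accxE : derive1 (derive1 x) t + nabla j (x t) (derive1 x t) (derive1 x t) =
    acceleration nabla gamma t j.
  rewrite (near_eq_derive1 x'E) (nbhs_singleton x'E) (nbhs_singleton xE) //.
have push : inclusion_push s (chart_map (a := phi_unit_bundle g phi) s (Gamma t))
    (acceleration nabla_hat Gamma t s) = 'D_acc f (w t).
  by rewrite (deriveEjacobian acc fd).
rewrite push -fw; apply/eqP; rewrite -subr_eq0; apply/eqP.
rewrite -accxE.
apply: (tangent_normal_span pkn Uw) => [b|]; first exact: orth.
rewrite (phi_sasaki_sym pkn _ _ (lp_cimg Uw)).
have Cw := lp_cimg Uw.
have lin k b c := phi_sasaki_linearr pkn (vlift (rsubmx (f (w t)))) k b c Cw.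
(* Both terms are orthogonal to the vertical lift of xi: the first is horizontal, the second tangent
   to the hypersurface. The difference is recast to fit linearity in the second argument. *)
rewrite [X in phi_sasaki _ _ _ _ _ _ X](_ : _ = (-1) *: hlift nabla j (f (w t))
  (derive1 (derive1 x) t + nabla j (x t) (derive1 x t) (derive1 x t)) + 'D_acc f (w t)).
  rewrite lin !(phi_sasaki_sym pkn (vlift _) _ Cw).
  have pR := pkn_metric pkn; have pc := lc_connection (pkn_levi_civita pkn).
  by rewrite (phi_sasaki_hv nabla phi pR Cw) (normal_orthogonal pkn acc Uw) mulr0 addr0.
by rewrite scaleN1r addrC.
Qed.

End LiftAcceleration.

(** * Local parametrizations of the unit bundle *)

Section Transitions.
Context {R : realType} {d : nat} {M : atlas R d}.
Hypothesis Mm : smooth_manifold M.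

Lemma transition_differentiable (i j : chart M) p : cdom i p -> cdom j p ->
  differentiable (transition i j) (chart_map i p).
Proof.
move=> ip jp; apply: smooth_on_differentiable (smooth_transition Mm i j) _.
by exists p.
Qed.

Lemma transition_map (i j : chart M) p : cdom i p ->
  transition i j (chart_map i p) = chart_map j p.
Proof. by move=> ip; rewrite /transition /= (chart_mapK Mm ip). Qed.

Lemma jacobian_transition_id (i : chart M) p : cdom i p ->
  'J (transition i i) (chart_map i p) = 1%:M.
Proof.
move=> ip; rewrite -(jacobian_id (chart_map i p)).
apply: near_eq_jacobian; last exact: transition_differentiable.
have Ci : cimg i (chart_map i p) by exists p.
by apply: filterS (open_near (cimg_open (i := i) Mm) Ci) => _ [q iq <-]; exact: transition_map.
Qed.

Lemma jacobian_transition_comp (i j k : chart M) p : cdom i p -> cdom j p -> cdom k p ->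
  'J (transition i k) (chart_map i p) =
  'J (transition i j) (chart_map i p) *m 'J (transition j k) (chart_map j p).
Proof.
move=> ip jp kp; have dij := transition_differentiable ip jp.
have djk := transition_differentiable jp kp.
have djk' : differentiable (transition j k) (transition i j (chart_map i p)).
  by rewrite transition_map.
rewrite -(transition_map j ip) -(jacobian_comp dij djk').
apply: near_eq_jacobian; last exact: transition_differentiable.
have Oij := @open_overlap _ _ _ Mm i j.
have xij : (chart_map i @` (cdom i `&` cdom j)) (chart_map i p) by exists p.
apply: filterS (open_near Oij xij) => _ [q [iq jq] <-].
by rewrite /= transition_map // [transition i j _]transition_map // transition_map.
Qed.

Lemma tangent_of_chart_tangent (i : chart M) p u : cdom i p ->
  tangent p (tangent_of_chart i p u).
Proof.
move=> ip; split=> [j k jp kp|j jp]; rewrite /tangent_of_chart; last first.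
  by case: asboolP.
rewrite (asboolT jp) (asboolT kp).
exact: etrans (f_equal (mulmx u) (jacobian_transition_comp ip jp kp)) (mulmxA _ _ _).
Qed.

Lemma tangent_of_chartE (i : chart M) p u : cdom i p -> tangent_of_chart i p u i = u.
Proof.
move=> ip; rewrite /tangent_of_chart (asboolT ip).
by rewrite jacobian_transition_id // mulmx1.
Qed.

End Transitions.

Section SmoothMaps.
Context {R : realType}.

Lemma Ck_mulmxr k p q (U : set 'rV[R]_p) (B : 'M[R]_(p, q)) :
  open U -> Ck k U (fun z : 'rV[R]_p => z *m B).
Proof.
move=> oU; have lc : continuous (mulmxr B : 'rV[R]_p -> 'rV[R]_q).
  exact: linear_rV_continuous (@mulmxr_linear_rV _ _ _ B).
by apply: Ck_ext (Ck_affine k 0 oU lc) => // z _; rewrite addr0.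
Qed.

Lemma Ck_comp_lsubmx (W : normedModType R) k p (U : set 'rV[R]_p) (f : 'rV[R]_p -> W) :
  open U -> Ck k U f ->
  Ck k [set z : 'rV[R]_(p + p) | U (lsubmx z)] (fun z : 'rV[R]_(p + p) => f (lsubmx z)).
Proof.
move=> oU fU.
have H := Ck_comp_affine 0 oU (@continuous_lsubmx R 1 p p) fU.
have E (z : 'rV[R]_(p + p)) : lsubmx z + 0 = lsubmx z by rewrite addr0.
have {}H : Ck k [set z : 'rV[R]_(p + p) | U (lsubmx z)]
    (fun z : 'rV[R]_(p + p) => f (lsubmx z + 0)).
  by apply: Ck_subset H => z /=; rewrite E.
apply: Ck_ext H => [|z _]; last by rewrite E.
by apply: (@open_comp _ _ (lsubmx : 'rV[R]_(p + p) -> _)) => // z _; exact: continuous_lsubmx.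
Qed.

End SmoothMaps.

Section LocalParamExistence.
Context {R : realType} {m : nat} {M : atlas R m.*2}.
Context {g : form_field M} {nabla : conn_field M} {phi : endo_field M}.
Hypothesis pkn : para_kahler_norden g nabla phi.
Notation n := m.*2.

Let gR := pkn_metric pkn.
Let Mm := pkn_manifold pkn.

Variable i : chart M.

Definition unit_form (z : 'rV[R]_(n + n)) : R :=
  g i (lsubmx z) (rsubmx z) (rsubmx z *m phi i (lsubmx z)).

Let D : set 'rV[R]_(n + n) := [set z | cimg i (lsubmx z)].

Let oD : open D.
Proof.
apply: (@open_comp _ _ (lsubmx : 'rV[R]_(n + n) -> 'rV[R]_n)).
  by move=> z _; exact: continuous_lsubmx.
exact: cimg_open Mm.
Qed.

(** The unit condition is imposed in all charts around the point; tensoriality of g and phi deduces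
    it from the single chart [i]. *)
Lemma unit_bundle_image z : cimg i (lsubmx z) -> unit_form z = 1 ->
  (chart_map (a := tangent_bundle M) i @`
    (phi_unit_set g phi `&` cdom (a := tangent_bundle M) i)) z.
Proof.
move=> [p ip px] z1; pose v := tangent_of_chart i p (rsubmx z).
have pc : carrier M p by exact: cdom_carrier Mm _ _ ip.
have vT : tangent p v by exact: (tangent_of_chart_tangent Mm).
have vi : v i = rsubmx z by exact: (tangent_of_chartE Mm).
exists (p, v); last by rewrite /= vi px hsubmxK.
split; last by split.
split; first by split.
move=> k kp /=; have [vik _] := vT; rewrite (vik i k ip kp) vi.
rewrite -mulmxA -(endo_tensorial (pkn_tensor pkn) ip kp) mulmxA.
by rewrite -(metric_tensorial gR ip kp) px.
Qed.

Lemma Ck_unit_form k : Ck k D unit_form.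
Proof.
have oC := cimg_open (i := i) Mm.
(* These are the coefficients g(e_a, phi e_b) of the quadratic form in xi, expanded so that
   smoothness follows from sums and products. *)
pose h a b x := \sum_(c < n) phi i x b c *: g i x (delta_mx 0 a) (delta_mx 0 c).
have hC a b : Ck k (cimg i) (h a b).
  apply: Ck_sum => // c; apply: Ck_scale => //; last exact: metric_smooth gR _ _ _ _.
  by apply: Ck_coord => //; exact: endo_smooth (pkn_tensor pkn) i k.
have cD (a : 'I_(n + n)) : Ck k D (fun z : 'rV[R]_(n + n) => z 0 a).
  apply: Ck_ext (Ck_coord 0 a oD (Ck_mulmxr k 1%:M oD)) => // z _; by rewrite mulmx1.
have H := Ck_sum (index_enum 'I_n) oD (fun a => Ck_sum (index_enum 'I_n) oD (fun b =>
  Ck_scale oD (cD (rshift n a)) (Ck_scale oD (cD (rshift n b))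
    (Ck_comp_lsubmx oC (hC a b))))).
apply: Ck_ext H => // z Dz; rewrite /unit_form; set x := lsubmx z.
have gl v := @linear_rV_sum R R^o n (fun u => g i x u v)
  (fun a u u' => metric_linear gR Dz v a u u').
have gr u := @linear_rV_sum R R^o n (fun v => g i x u v)
  (fun a v v' => metric_linearr pkn Dz u a v v').
rewrite [RHS]gl; apply: eq_bigr => a _; rewrite mxE -scaler_sumr; congr (_ *: _).
rewrite (_ : g i x _ _ = \sum_(b < n) (rsubmx z) 0 b *:
  (g i x (delta_mx 0 a) (delta_mx 0 b *m phi i x) : R^o)); last first.
  have lin c u u' : g i x (delta_mx 0 a) ((c *: u + u') *m phi i x) =
      c *: (g i x (delta_mx 0 a) (u *m phi i x) : R^o) + g i x (delta_mx 0 a) (u' *m phi i x).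
    by rewrite mulmxDl -scalemxAl; exact: (metric_linearr pkn Dz (delta_mx 0 a) c).
  exact: (@linear_rV_sum R R^o n (fun v => g i x (delta_mx 0 a) (v *m phi i x)) lin).
apply: eq_bigr => b _; rewrite mxE; congr (_ *: _).
rewrite /h gr; apply: eq_bigr => c _; congr (_ *: _).
by rewrite -rowE mxE.
Qed.

End LocalParamExistence.

(** * Radial projection of an affine hyperplane onto the hypersurface *)

Section RadialParam.
Context {R : realType} {m : nat} {M : atlas R m.*2}.
Context {g : form_field M} {nabla : conn_field M} {phi : endo_field M}.
Hypothesis pkn : para_kahler_norden g nabla phi.
Notation n := m.*2.

Let gR := pkn_metric pkn.
Let Mm := pkn_manifold pkn.

Variables (i : chart M) (a : 'I_n) (c : R).
Hypothesis c0 : c != 0.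

Let D : set 'rV[R]_(n + n) := [set z | cimg i (lsubmx z)].
Let k : 'I_(n + n) := rshift n a.
Let oD : open D.
Proof.
apply: (@open_comp _ _ (lsubmx : 'rV[R]_(n + n) -> 'rV[R]_n)).
  by move=> z _; exact: continuous_lsubmx.
exact: cimg_open Mm.
Qed.

Let Phi : 'rV[R]_(n + n) -> R := unit_form (g := g) (phi := phi) i.

Let P1 : 'M[R]_(n + n) := block_mx 1%:M 0 0 0.
Let P2 : 'M[R]_(n + n) := block_mx 0 0 0 1%:M.
(** Right multiplication by [E] inserts a zero at coordinate [k]; by [E^T] it deletes that
    coordinate. *)
Let E : 'M[R]_((n + n).-1, n + n) := row' k 1%:M.

(** Fibrewise scaling, written with constant matrices so that the regularity lemmas for linear maps
    and scalar products apply. *)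
Definition stretch (r : R) (z : 'rV[R]_(n + n)) : 'rV[R]_(n + n) :=
  z *m P1 + r *: (z *m P2).

Lemma stretchE r z : stretch r z = row_mx (lsubmx z) (r *: rsubmx z).
Proof.
rewrite /stretch -{1 2}[z]hsubmxK !mul_row_block !mulmx0 !mulmx1 !addr0 !add0r.
by rewrite scale_row_mx scaler0 add_row_mx addr0 add0r.
Qed.

Lemma stretch_comp r r' z : stretch r (stretch r' z) = stretch (r * r') z.
Proof. by rewrite !stretchE row_mxKl row_mxKr scalerA. Qed.

Lemma stretch1 z : stretch 1 z = z.
Proof. by rewrite stretchE scale1r hsubmxK. Qed.

Lemma stretch_coord r z : stretch r z 0 k = r * z 0 k.
Proof. by rewrite stretchE row_mxEr !mxE. Qed.

Lemma stretch_cimg r z : D z -> D (stretch r z).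
Proof. by rewrite /D /= stretchE row_mxKl. Qed.

Lemma unit_form_stretch r z : D z -> Phi (stretch r z) = r ^+ 2 * Phi z.
Proof.
move=> Dz; rewrite /Phi /unit_form stretchE row_mxKl row_mxKr -scalemxAl.
rewrite (metricZl pkn _ _ _ Dz) (Defs.metric_sym gR Dz) (metricZl pkn _ _ _ Dz).
by rewrite (Defs.metric_sym gR Dz) mulrA.
Qed.

Let slice (y : 'rV[R]_(n + n).-1) : 'rV[R]_(n + n) := y *m E + c *: delta_mx 0 k.

Lemma slice_lift y l : slice y 0 (lift k l) = y 0 l.
Proof.
rewrite /slice !mxE (bigD1 l) //= big1 => [|q ql].
  by rewrite !mxE eqxx mulr1 /= [lift k l == k]eq_sym (negbTE (neq_lift _ _)) mulr0 !addr0.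
by rewrite !mxE (inj_eq lift_inj) (negbTE ql) mulr0.
Qed.

Lemma slice_k y : slice y 0 k = c.
Proof.
rewrite /slice !mxE big1 ?eqxx ?mulr1 ?add0r // => q _.
by rewrite !mxE [lift k q == k]eq_sym (negbTE (neq_lift _ _)) mulr0.
Qed.

Lemma mul_trE (z : 'rV[R]_(n + n)) l : (z *m E^T) 0 l = z 0 (lift k l).
Proof.
rewrite !mxE (bigD1 (lift k l)) //= big1 => [|q ql]; last first.
  by rewrite !mxE eq_sym (negbTE ql) mulr0.
by rewrite !mxE eqxx mulr1 addr0.
Qed.

Lemma sliceK y : slice y *m E^T = y.
Proof. by apply/rowP => l; rewrite mul_trE slice_lift. Qed.

Lemma slice_mul_tr (z : 'rV[R]_(n + n)) : z 0 k = c -> slice (z *m E^T) = z.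
Proof.
move=> zk; apply/rowP => l; case: (unliftP k l) => [q ->|->].
  by rewrite slice_lift mul_trE.
by rewrite slice_k zk.
Qed.

Let dom : set 'rV[R]_(n + n) := [set z | D z /\ 0 < Phi z].
(** [rho] moves a point along its ray in the fibre to [Phi = 1], [Phi] being homogeneous of degree 2
    there; [nu] moves it along the same line to the hyperplane where coordinate [k] is [c]. *)
Let rho (z : 'rV[R]_(n + n)) := stretch (Num.sqrt (Phi z))^-1 z.
Let nu (z : 'rV[R]_(n + n)) := stretch (c / z 0 k) z.
Let F y := rho (slice y).
Let Finv (z : 'rV[R]_(n + n)) := nu z *m E^T.

Let odom : open dom.
Proof.
rewrite openE => z [Dz Pz].
have Pc : Phi @ z --> Phi z := Ck_unit_form pkn i 0 z Dz.
have P0 : \forall q \near z, 0 < Phi q by exact: cvgr_gt Pc _ Pz.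
by apply: filterS2 (open_near oD Dz) P0.
Qed.

Lemma Ck_rho l : Ck l dom rho.
Proof.
have PU : Ck l dom Phi by apply: Ck_subset (Ck_unit_form pkn i l) => z [].
have rU := Ck_rsqrt odom (fun z (Uz : dom z) => Uz.2) PU.
exact: Ck_add odom (Ck_mulmxr l P1 odom) (Ck_scale odom rU (Ck_mulmxr l P2 odom)).
Qed.

Let Fdom : set 'rV[R]_(n + n).-1 := [set y | dom (slice y)].

Let slice_continuous : continuous slice.
Proof.
move=> y; apply: differentiable_continuous.
have H := is_diffD (is_diff_linear_rV y (@mulmxr_linear_rV R _ _ E))
  (is_diff_cst (c *: delta_mx 0 k) y).
exact: (@ex_diff _ _ _ _ _ _ _ H).
Qed.

Let oFdom : open Fdom.
Proof. by apply: (@open_comp _ _ slice) odom => y _; exact: slice_continuous. Qed.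

Let F_smooth : smooth_on Fdom F.
Proof.
move=> l; have Ec : continuous (mulmxr E : 'rV[R]_(n + n).-1 -> _).
  exact: linear_rV_continuous (@mulmxr_linear_rV _ _ _ E).
exact: (Ck_comp_affine (c *: delta_mx 0 k) odom Ec (Ck_rho l)).
Qed.

(** The sign condition makes [c / z 0 k] positive, hence equal to the square root of its square
    [Phi (nu z)]; with the other sign [rho] would return the opposite vector of the fibre. *)
Let nuK (z : 'rV[R]_(n + n)) : D z -> Phi z = 1 -> 0 < c * z 0 k -> dom (nu z) /\ rho (nu z) = z.
Proof.
move=> Dz z1 czk.
have zk : z 0 k != 0 by apply: contraTneq czk => ->; rewrite mulr0 ltxx.
have czk' : 0 < c / z 0 k.
  by rewrite -(pmulr_lgt0 _ (_ : 0 < z 0 k ^+ 2)) ?exprn_even_gt0 //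
       expr2 mulrA divfK.
have PE : Phi (nu z) = (c / z 0 k) ^+ 2 by rewrite unit_form_stretch // z1 mulr1.
split; first by split; [exact: stretch_cimg|rewrite PE exprn_gt0].
rewrite /rho PE sqrtr_sqr gtr0_norm // /nu stretch_comp mulVf ?stretch1 //.
by rewrite gt_eqF.
Qed.

Let rhoK y : Fdom y -> [/\ D (F y), Phi (F y) = 1, 0 < c * F y 0 k & Finv (F y) = y].
Proof.
move=> [Dy Py]; have s0 : 0 < Num.sqrt (Phi (slice y)) by rewrite sqrtr_gt0.
have Fk : F y 0 k = (Num.sqrt (Phi (slice y)))^-1 * c by rewrite stretch_coord slice_k.
split.
- exact: stretch_cimg.
- by rewrite unit_form_stretch // exprVn sqr_sqrtr ?mulVf ?gt_eqF // ltW.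
- by rewrite Fk mulrCA mulr_gt0 ?invr_gt0 // -expr2 exprn_even_gt0.
rewrite /Finv /nu Fk /F /rho stretch_comp.
have -> : c / ((Num.sqrt (Phi (slice y)))^-1 * c) * (Num.sqrt (Phi (slice y)))^-1 = 1.
  by field; rewrite c0 gt_eqF.
by rewrite stretch1 sliceK.
Qed.

Let Finv_differentiable (z : 'rV[R]_(n + n)) : z 0 k != 0 -> differentiable Finv z.
Proof.
move=> zk.
have l1 := is_diff_linear_rV z (@mulmxr_linear_rV R _ _ P1).
have l2 := is_diff_linear_rV z (@mulmxr_linear_rV R _ _ P2).
have ck : differentiable (fun q : 'rV[R]_(n + n) => (q 0 k)^-1) z.
  by apply: differentiableV zk; exact: differentiable_coord.
have H := is_diffD l1 (is_diff_scale (differentiableP ck) (is_diffZ c l2)).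
have {}H := is_diff_linear_comp (@mulmxr_linear_rV R _ _ E^T) H.
have /(is_diff_ext _ (fun=> erefl)) {}H := H.
apply: (@ex_diff _ _ _ _ _ _ _ (H Finv _)) => q.
by rewrite /Finv /nu /stretch mulrC -scalerA.
Qed.

(** [Finv] is a differentiable left inverse of [F], so its Jacobian is a right inverse of that of
    [F] in the row convention. *)
Let F_immersion y : Fdom y -> row_free ('J F y).
Proof.
move=> Uy; have [_ _ ck _] := rhoK Uy.
have Fk : F y 0 k != 0 by apply: contraTneq ck => ->; rewrite mulr0 ltxx.
have Fd := smooth_on_differentiable F_smooth Uy.
apply/row_freeP; exists ('J Finv (F y)).
rewrite -(jacobian_comp Fd (Finv_differentiable Fk)) -(jacobian_id y).
apply: near_eq_jacobian; last exact: differentiable_comp Fd (Finv_differentiable Fk).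
by apply: filterS (open_near oFdom Uy) => q /rhoK[].
Qed.

Let S := phi_unit_set g phi.
Let TM := tangent_bundle M.

Let F_embedding (W : set 'rV[R]_(n + n).-1) : open W -> W `<=` Fdom ->
  exists2 B, open B &
    F @` W = B `&` (chart_map (a := TM) i @` (S `&` cdom (a := TM) i)).
Proof.
(* The inequality selects the side of the hypersurface that [F] reaches, and there [Finv] is
   continuous, which makes this set open. *)
move=> oW WF; exists [set z : 'rV[R]_(n + n) | 0 < c * z 0 k /\ W (Finv z)].
  rewrite openE => z [ck Wz].
  have zk : z 0 k != 0 by apply: contraTneq ck => ->; rewrite mulr0 ltxx.
  have kc : (fun q : 'rV[R]_(n + n) => c * q 0 k) @ z --> c * z 0 k.
    have H := is_diffZ c (differentiableP (@differentiable_coord R 1 (n + n) z 0 k)).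
    exact: (differentiable_continuous (@ex_diff _ _ _ _ _ _ _ H)).
  have k0 : \forall q \near z, 0 < c * (q : 'rV[R]_(n + n)) 0 k by exact: cvgr_gt kc _ ck.
  have Wn : \forall q \near z, W (Finv q).
    exact: (differentiable_continuous (Finv_differentiable zk) (open_near oW Wz)).
  by apply: filterS2 k0 Wn.
apply/seteqP; split=> [_ [y Wy <-]|z [[ck Wz] [q [Sq [qc qT iq]] qz]]].
  have [DF P1F ck FK] := rhoK (WF _ Wy).
  by split; [split=> //=; rewrite FK|have := unit_bundle_image pkn DF P1F; exact].
have Dz : D z by rewrite -qz /D /= row_mxKl; exists q.1.
have z1 : Phi z = 1.
  by rewrite -qz /Phi /unit_form row_mxKl row_mxKr; case: Sq => _; exact.
have [_ rz] := nuK Dz z1 ck; exists (Finv z) => //.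
rewrite /F /Finv slice_mul_tr // stretch_coord divfK //.
by apply: contraTneq ck => ->; rewrite mulr0 ltxx.
Qed.

(* The slice [z 0 k = c] is mapped onto the part of the hypersurface where
   [c * z 0 k > 0]. *)
Definition radial_param : local_param S (n + n).-1 :=
  LocalParam (lp_chart := i : chart TM) oFdom (fun y Uy => let: And4 _ _ _ FK := rhoK Uy in FK)
    F_smooth F_immersion F_embedding.

Lemma radial_param_cdom q : S q -> cdom i q.1 -> 0 < c * q.2 i 0 a ->
  cdom (a := phi_unit_bundle g phi) radial_param q.
Proof.
move=> Sq iq cq; have [[qc qT] q1] := Sq.
pose z : 'rV[R]_(n + n) := chart_map (a := TM) i q.
have Dz : D z by rewrite /D /= row_mxKl; exists q.1.
have z1 : Phi z = 1 by rewrite /Phi /unit_form row_mxKl row_mxKr; exact: q1.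
have zk : z 0 k = q.2 i 0 a by rewrite [LHS]row_mxEr.
have ck : 0 < c * z 0 k by rewrite zk.
have k0 : z 0 k != 0 by apply: contraTneq ck => ->; rewrite mulr0 ltxx.
have [dz rz] := nuK Dz z1 ck.
have sl : slice (Finv z) = nu z by rewrite slice_mul_tr // stretch_coord divfK.
split=> //; exists (Finv z); first by rewrite /= /Fdom /= sl.
by rewrite /= /F sl.
Qed.

End RadialParam.

Lemma exists_local_param {R : realType} {m : nat} {M : atlas R m.*2}
    {g : form_field M} {nabla : conn_field M} {phi : endo_field M}
    (i : chart M) (q : mpoint (tangent_bundle M)) :
  para_kahler_norden g nabla phi -> phi_unit_set g phi q -> cdom i q.1 ->
  exists2 s : chart (phi_unit_bundle g phi), lp_chart s = i & cdom s q.
Proof.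
move=> pkn Sq iq; have [_ /(_ i iq) q1] := Sq.
have Ci : cimg i (chart_map i q.1) by exists q.1.
have : q.2 i != 0.
  by apply: contra_eq_neq q1 => ->; rewrite (metric0l pkn _ Ci) eq_sym oner_eq0.
(* The constant [c] is the nonzero coordinate itself, so that [c] times this coordinate is a
   positive square. *)
case/rV0Pn => a qa; exists (radial_param pkn i a qa) => //.
by apply: radial_param_cdom => //; rewrite -expr2 exprn_even_gt0.
Qed.

(** * Equivalence of the equations for the curve and for its lift *)

Section LiftEquation.
Context {R : realType} {m : nat} {M : atlas R m.*2}.
Context {g : form_field M} {nabla : conn_field M} {phi : endo_field M}.
Context {nabla_hat : conn_field (phi_unit_bundle g phi)}.
Hypothesis pkn : para_kahler_norden g nabla phi.
Hypothesis lch : levi_civita (phi_unit_metric g phi nabla) nabla_hat.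
Variables (F : endo_field M) (I : set R) (gamma : R -> mpoint M).
Variable xi : R -> chart M -> 'rV[R]_(m.*2).
Let Gamma : R -> mpoint (tangent_bundle M) := fun t => (gamma t, xi t).
Hypotheses (Is : smooth_curve I Gamma) (hor : horizontal_along nabla I gamma xi).
Hypothesis Iunit : forall t, I t -> phi_unit_set g phi (Gamma t).

Lemma hlift_combination (i : chart M) z a b u v : cimg i (lsubmx z) ->
  hlift nabla i z (a *: u + b *: v) = a *: hlift nabla i z u + b *: hlift nabla i z v.
Proof.
move=> Cz; have cn := lc_connection (pkn_levi_civita pkn).
rewrite /hlift (conn_linearl cn Cz).
have /= := conn_linearl cn Cz (rsubmx z) b v 0.
rewrite addr0 (conn0l pkn _ Cz) addr0 => ->.
by rewrite !scale_row_mx add_row_mx opprD !scalerN.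
Qed.

(** Every term upstairs is the horizontal lift of its counterpart downstairs, and the horizontal
    lift is linear and injective. The coefficients are fixed, so the same functions of t serve on
    both sides. *)
Lemma lift_equation (a b : R) t (s : chart (phi_unit_bundle g phi)) :
  I t -> cdom s (Gamma t) ->
  let j : chart M := lp_chart s in
  let Gamma' := velocity (M := tangent_bundle M) Gamma t j in
  inclusion_push s (chart_map s (Gamma t)) (acceleration nabla_hat Gamma t s) =
    a *: Gamma' + b *: endo_hlift nabla F j (chart_map (a := tangent_bundle M) j (Gamma t)) Gamma'
  <-> acceleration nabla gamma t j =
    a *: velocity gamma t j + b *: (velocity gamma t j *m F j (chart_map j (gamma t))).
Proof.
move=> It st j Gamma'; have [_ jt _] := st.
have Cz : cimg j (lsubmx (chart_map (a := tangent_bundle M) j (Gamma t))).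
  by rewrite row_mxKl; case: jt => _ _ jt; exists (gamma t).
rewrite (acceleration_lift pkn lch Is hor Iunit It st).
have -> : Gamma' = hlift nabla j (chart_map (a := tangent_bundle M) j (Gamma t))
    (velocity gamma t j) by exact: (lift_velocity Is hor).
rewrite endo_hlift_h -(hlift_combination _ _ _ _ Cz) row_mxKl.
split=> [/(f_equal hpart)|->//].
by rewrite !hpart_hlift.
Qed.

End LiftEquation.

Theorem theorem5p13 (R : realType) (m : nat) (M : atlas R m.*2)
    (g : form_field M) (nabla : conn_field M) (phi F : endo_field M)
    (nabla_hat : conn_field (phi_unit_bundle g phi))
    (I : set R) (gamma : R -> mpoint M) (xi : R -> chart M -> 'rV[R]_(m.*2)) :
  let Gamma : R -> mpoint (tangent_bundle M) := fun t => (gamma t, xi t) in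
  para_kahler_norden g nabla phi ->
  endo_tensor F ->
  levi_civita (phi_unit_metric g phi nabla) nabla_hat ->
  open I -> is_interval I ->
  smooth_curve I Gamma ->
  horizontal_along nabla I gamma xi ->
  (forall t, I t -> phi_unit_set g phi (Gamma t)) ->
  (HF_planar nabla nabla_hat F I Gamma <-> F_planar nabla F I gamma) /\
  (HF_geodesic nabla nabla_hat F I Gamma <-> F_geodesic nabla F I gamma).
Proof.
move=> Gamma pkn _ lch _ _ Is hor Iunit.
have eqv a b t s It st := @lift_equation R m M g nabla phi nabla_hat pkn lch F I
  gamma xi Is hor Iunit a b t s It st.
(* [F_planar] and [F_geodesic] quantify over all charts of M around the point, while the equation
   upstairs is known only in local parametrizations. *)
have param t i (It : I t) : cdom i (gamma t) ->
    exists2 s : chart (phi_unit_bundle g phi), lp_chart s = i & cdom s (Gamma t).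
  by move=> it; exact: exists_local_param pkn (Iunit t It) it.
split; split.
- move=> [a [b H]]; exists a, b => t It i it.
  by have [s <- st] := param t i It it; apply/(eqv _ _ _ _ It st); exact: H.
- move=> [a [b H]]; exists a, b => t It s st.
  by apply/(eqv _ _ _ _ It st)/H => //; case: st => _ [].
- move=> H t It i it; have [s <- st] := param t i It it.
  (* The geodesic equation is the case of constant coefficients 0 and 1. *)
  have := (eqv 0 1 _ _ It st).1; rewrite !scale0r !add0r !scale1r; apply.
  exact: H.
- move=> H t It s st.
  have := (eqv 0 1 _ _ It st).2; rewrite !scale0r !add0r !scale1r; apply.
  by apply: H => //; case: st => _ [].
Qed.
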